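(* Let $n>k\ge 1$ be integers, $r=n-k$, and let $\alpha$ be an integer with $2\le \alpha\le r$. Let $q$ be a prime power with $$q>\binom{n-1}{k-1}-\binom{\lceil n/\alpha\rceil-1}{\lceil k/\alpha\rceil-1}.$$ Then there exists a choice of all the coefficients $\theta$ (taken in $\mathbb{F}_q\setminus\{0,1\}$) appearing in the construction of the set transformed code ST-RS$(n,k,\alpha)$ over $\mathbb{F}_q$ (described in the context) such that the resulting code is an MDS array code, i.e., the $k\alpha$ data symbols can be recovered from the $k\alpha$ symbols stored in any $k$ of the $n$ nodes.
   Context: **Base code.** Fix a systematic $(n,k)$ Reed–Solomon (MDS) code over $\mathbb{F}_q$: a data vector $\boldsymbol a=(a_1,\dots,a_k)$ is encoded as $(a_1,\dots,a_k,f_1(\boldsymbol a),\dots,f_r(\boldsymbol a))$ with linear parity functions $f_s$. Form an $\alpha\times n$ array whose $i$-th row ($i=1,\dots,\alpha$) is the codeword of an independent data vector $\boldsymbol a_i=(a_{i,1},\dots,a_{i,k})$. There are $k\alpha$ data symbols in total. **Set transformation of an $\alpha\times\beta$ array with $\alpha\le\beta<2\alpha$.** Let the entries be $b_{i,j}$ ($1\le i\le\alpha$, $1\le j\le\beta$), and put $m=2\alpha-\beta$. For $j>m$ define the column indices $c_1(j)=2j-2\alpha+\beta-1$ and $c_2(j)=2j-2\alpha+\beta$. The transformed entries $b'_{i,j}$ are defined region by region as follows. (A) For $i,j\le m$: - $b'_{i,j}=b_{i,j}+b_{j,i}$ if $i<j$; - $b'_{i,i}=b_{i,i}$; - $b'_{i,j}=b_{i,j}+\theta_{i,j}b_{j,i}$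 if $i>j$. (B1) For $i\le m<j\le\alpha$: - $b'_{i,c_1(j)}=b_{i,c_1(j)}+b_{j,i}$; - $b'_{i,c_2(j)}=b_{i,c_2(j)}$. (B2) For $j\le m<i\le\alpha$: - $b'_{i,j}=b_{i,j}+\theta_{i,j}\bigl(b_{j,c_1(i)}+b_{j,c_2(i)}\bigr)$. (C) For $m<i,j\le\alpha$: - if $i>j$: $b'_{i,c_1(j)}=b_{i,c_1(j)}+\theta_{i,c_1(j)}b_{j,c_1(i)}$ and $b'_{i,c_2(j)}=b_{i,c_2(j)}+\theta_{i,c_2(j)}b_{j,c_2(i)}$; - if $i=j$: $b'_{i,c_1(i)}=b_{i,c_1(i)}$ and $b'_{i,c_2(i)}=b_{i,c_2(i)}$; - if $i<j$: $b'_{i,c_1(j)}=b_{i,c_1(j)}+b_{j,c_1(i)}$ and $b'_{i,c_2(j)}=b_{i,c_2(j)}+b_{j,c_2(i)}$. All $\theta$'s are coefficients in $\mathbb{F}_q\setminus\{0,1\}$. When $\beta=\alpha$ (so $m=\alpha$), only region (A) occurs. **The code ST-RS$(n,k,\alpha)$.** Let $L=\lfloor n/\alpha\rfloor$. Partition the $n$ columns of the $\alpha\times n$ base array into $L$ consecutive blocks: the first $L-1$ blocks have $\alpha$ columns each, and the last block has $\alpha+(n\bmod\alpha)$ columns (which is $<2\alpha$). Apply the set transformation independently to each block, each block having its own coefficients $\theta$. The resulting $\alpha\times n$ array is the codeword, and node $j$ stores the $\alpha$ symbols of column $j$, for $j=1,\dots,n$. *)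

(* Defs.v *)
(* All array/column/row indices below are 1-based naturals,
   exactly as in the paper; arrays are functions nat -> nat -> F
   (row index first, column index second). *)
From HB Require Import structures.
From mathcomp Require Import all_boot all_order all_algebra.
Set Implicit Arguments. Unset Strict Implicit. Unset Printing Implicit Defensive.
Import GRing.Theory.
Local Open Scope ring_scope.

Definition ceil_div (a b : nat) : nat := ((a + b.-1) %/ b)%N.

(* Evaluation points x_1..x_n (pairwise distinct).  The systematic RS
   codeword of a data vector (a_1..a_k) is (p(x_1),...,p(x_n)) where p is the
   unique polynomial of degree < k with p(x_t) = a_t for t <= k; hence
   f_s(a) = p(x_{k+s}) given by Lagrange interpolation. *)
Definition lagrange_eval {F : fieldType} (k : nat) (x : nat -> F)
    (a : nat -> F) (y : F) : F :=
  \sum_(1 <= t < k.+1)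
     a t * \prod_(1 <= u < k.+1 | u != t) ((y - x u) / (x t - x u)).

Definition base_array {F : fieldType} (k : nat) (x : nat -> F)
    (d : nat -> nat -> F) (i j : nat) : F :=
  if (j <= k)%N then d i j else lagrange_eval k x (d i) (x j).

Definition st_c1 (alpha beta j : nat) : nat := (2 * j + beta - 1 - 2 * alpha)%N.
Definition st_c2 (alpha beta j : nat) : nat := (2 * j + beta - 2 * alpha)%N.

(* Entry b'_{i,j} of the transformed array (1 <= i <= alpha, 1 <= j <= beta),
   th i j = theta_{i,j}.  For a column j > m, jj is the unique index
   m < jj <= alpha with j = c1(jj) (when j - m is odd) or j = c2(jj)
   (when j - m is even). *)
Definition set_transform {F : fieldType} (alpha beta : nat)
    (th : nat -> nat -> F) (B : nat -> nat -> F) (i j : nat) : F :=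
  let m := (2 * alpha - beta)%N in
  let c1 := st_c1 alpha beta in
  let c2 := st_c2 alpha beta in
  if (j <= m)%N then
    if (i <= m)%N then
      if (i < j)%N then B i j + B j i
      else if i == j then B i i
      else B i j + th i j * B j i
    else
      B i j + th i j * (B j (c1 i) + B j (c2 i))
  else
    let jj := (m + (j - m).+1./2)%N in
    let is_c1 := odd (j - m) in
    if (i <= m)%N then
      if is_c1 then B i j + B jj i else B i j
    else
      let ci := if is_c1 then c1 i else c2 i in
      if (jj < i)%N then B i j + th i j * B jj ci
      else if i == jj then B i j
      else B i j + B jj ci.

(* Blocks b = 0..L-1 (L = n / alpha); block b covers columns
   b*alpha+1 .. b*alpha+width, width = alpha except for the last block, of
   width alpha + (n mod alpha).  theta b i j is the coefficient theta_{i,j}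
   of block b (j = column index local to the block). *)
Definition st_block (n alpha j : nat) : nat :=
  minn ((j.-1) %/ alpha) ((n %/ alpha).-1).
Definition st_width (n alpha b : nat) : nat :=
  if b == (n %/ alpha).-1 then (alpha + n %% alpha)%N else alpha.

Definition st_rs_codeword {F : fieldType} (n k alpha : nat) (x : nat -> F)
    (theta : nat -> nat -> nat -> F) (d : nat -> nat -> F) (i j : nat) : F :=
  let b := st_block n alpha j in
  set_transform alpha (st_width n alpha b) (theta b)
    (fun i' j' => base_array k x d i' (b * alpha + j')%N) i (j - b * alpha)%N.

Definition st_rs_is_MDS {F : fieldType} (n k alpha : nat) (x : nat -> F)
    (theta : nat -> nat -> nat -> F) : Prop :=
  forall S : {set 'I_n}, #|S| = k ->
  forall d d' : nat -> nat -> F,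
    (forall (i : nat) (j : 'I_n), (1 <= i <= alpha)%N -> j \in S ->
        st_rs_codeword n k alpha x theta d i j.+1
        = st_rs_codeword n k alpha x theta d' i j.+1) ->
    forall i t, (1 <= i <= alpha)%N -> (1 <= t <= k)%N -> d i t = d' i t.

(* Main.v *)
Require Import Defs.
From HB Require Import structures.
From mathcomp Require Import all_boot all_order all_algebra all_field.
From mathcomp Require Import zify ring boolp.
Set Implicit Arguments. Unset Strict Implicit. Unset Printing Implicit Defensive.
Import GRing.Theory.
Local Open Scope ring_scope.
Local Arguments half n : simpl never.

(* Each transformed symbol is affine in the single coefficient [theta] attached
   to it, so the coefficients can be chosen one after the other.  With all
   coefficients zero the rows are decoded from the last one upwards, hence every
   set of [k] nodes recovers the data.  When one coefficient is then moved away
   from zero, a given set of [k] nodes fails for at most one value, and it never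
   fails if the factor of that coefficient already vanishes on the kernel of the
   set (the set is "protected").  Thus it suffices that, for every coefficient,
   at most [#|F| - 3] of the ['C(n.-1, k.-1)] sets containing its column are
   unprotected, the values 0 and 1 being also excluded.

   Protected sets come from two sources: those which contain the paired columns,
   and those which decode directly the row that the coefficient multiplies.
   Comparing binomial coefficients, and using [n <= #|F|] when [k <= 2], they are
   numerous enough except for the coefficient of the last block when
   (n, k, alpha) = (5, 3, 2) and [#|F| = 5]; there a value of the coefficient is
   found by an exhaustive search over the evaluation points. *)

(** * The set transformation of one block *)

(* The row whose entry in column [j] of the block is left unmixed. *)
Definition st_class (alpha beta j : nat) : nat :=
  let m := (2 * alpha - beta)%N in
  if (j <= m)%N then j else (m + (j - m).+1./2)%N.

(** The factor of [th i j] in the transformed entry [(i, j)]. It is 0 where the construction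
    attaches no coefficient, so that affinity holds at all positions alike. *)
Definition st_slope {F : fieldType} (alpha beta : nat) (B : nat -> nat -> F)
    (i j : nat) : F :=
  let m := (2 * alpha - beta)%N in
  if (j <= m)%N then
    if (i <= m)%N then (if (j < i)%N then B j i else 0)
    else B j (st_c1 alpha beta i) + B j (st_c2 alpha beta i)
  else
    let jj := (m + (j - m).+1./2)%N in
    if (i <= m)%N then 0
    else if (jj < i)%N then
      B jj (if odd (j - m) then st_c1 alpha beta i else st_c2 alpha beta i)
    else 0.

(* The columns which, together with [j], determine the slope at [(i, j)]. *)
Definition st_guard (alpha beta i j : nat) : seq nat :=
  let m := (2 * alpha - beta)%N in
  if (j <= m)%N then
    if (i <= m)%N then [:: i] else [:: st_c1 alpha beta i; st_c2 alpha beta i]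
  else [:: if odd (j - m) then st_c1 alpha beta i else st_c2 alpha beta i].

(* Column [c] is such that, once columns [c] and [c'] are known, so is the
   entry of row [st_class c'] in column [c]. *)
Definition st_linked (alpha beta c' c : nat) : bool :=
  let m := (2 * alpha - beta)%N in
  if (c' <= m)%N then (c <= m)%N || ~~ odd (c - m)
  else (m < c)%N && (odd (c - m) == odd (c' - m)).

Lemma set_transform_affine (F : fieldType) (alpha beta : nat)
    (th B : nat -> nat -> F) i j :
  set_transform alpha beta th B i j =
  set_transform alpha beta (fun _ _ => 0) B i j
    + th i j * st_slope alpha beta B i j.
Proof.
rewrite /set_transform /st_slope /=.
case: (leqP j (2 * alpha - beta)%N) => hj; case: (leqP i (2 * alpha - beta)%N) => hi.
- by case: ltngtP => [h|h|->]; ring.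
- ring.
- by case: ifP => ?; ring.
- by case: ltngtP => ?; ring.
Qed.

Lemma set_transform_comb (F : fieldType) (alpha beta : nat)
    (th B B' : nat -> nat -> F) (a a' : F) i j :
  set_transform alpha beta th (fun i j => a * B i j + a' * B' i j) i j =
  a * set_transform alpha beta th B i j + a' * set_transform alpha beta th B' i j.
Proof.
by rewrite /set_transform /=; do ![case: ifP => ?]; ring.
Qed.

Lemma st_slope_comb (F : fieldType) (alpha beta : nat)
    (B B' : nat -> nat -> F) (a a' : F) i j :
  st_slope alpha beta (fun i j => a * B i j + a' * B' i j) i j =
  a * st_slope alpha beta B i j + a' * st_slope alpha beta B' i j.
Proof.
by rewrite /st_slope /=; do ![case: ifP => ?]; ring.
Qed.

Lemma st_class_bounds (alpha beta j : nat) :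
  (alpha <= beta < 2 * alpha)%N -> (1 <= j <= beta)%N ->
  (1 <= st_class alpha beta j <= alpha)%N.
Proof. by rewrite /st_class => ? ?; case: ifP => ?; lia. Qed.

Lemma st_slope_trivial (F : fieldType) (alpha beta : nat)
    (B : nat -> nat -> F) i j :
  (i <= st_class alpha beta j)%N -> st_slope alpha beta B i j = 0.
Proof.
rewrite /st_slope /st_class /=; case: (leqP j (2 * alpha - beta)%N) => hj h; case: (leqP i (2 * alpha - beta)%N) => hi.
- by rewrite ltnNge h.
- lia.
- by [].
- by rewrite ltnNge h.
Qed.

(** All terms of the slope in column [j] lie in the unmixed row of that column, so decoding this
    single row kills the slope. *)
Lemma st_slope_row0 (F : fieldType) (alpha beta : nat)
    (B : nat -> nat -> F) i j :
  (alpha <= beta < 2 * alpha)%N -> (1 <= i <= alpha)%N -> (1 <= j <= beta)%N ->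
  (forall c, (1 <= c)%N -> B (st_class alpha beta j) c = 0) ->
  st_slope alpha beta B i j = 0.
Proof.
move=> hb hi hj; rewrite /st_slope /st_class /= /st_c1 /st_c2.
case: (leqP j (2 * alpha - beta)%N) => hm H; case: (leqP i (2 * alpha - beta)%N) => him //.
- by case: ifP => // _; apply: H; lia.
- by rewrite !H ?addr0 //; lia.
- by case: ifP => // _; apply: H; case: ifP; lia.
Qed.

(** The system has determinant [1 - t]: it is here that the coefficients must avoid 1. *)
Lemma pair_solve (F : fieldType) (u v t : F) :
  t != 1 -> u + v = 0 -> v + t * u = 0 -> u = 0 /\ v = 0.
Proof.
move=> t1 e1 e2; have ev : v = - u by rewrite -[v](addKr u) e1 addr0.
have : (t - 1) * u = 0 by rewrite -e2 ev; ring.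
move/eqP; rewrite mulf_eq0 subr_eq0 (negPf t1) /= => /eqP u0.
by rewrite ev u0 oppr0.
Qed.

(** Either the entry is stored unmixed, when the columns coincide or when [c] is a [c2] column and
    [c'] is among the first [m], or its partner lies in column [c'] and [pair_solve] applies. *)
Lemma st_linked_zero (F : fieldType) (alpha beta : nat)
    (th B : nat -> nat -> F) c' c :
  (alpha <= beta < 2 * alpha)%N ->
  (1 <= c' <= beta)%N -> (1 <= c <= beta)%N -> (forall i j, th i j != 1) ->
  st_linked alpha beta c' c ->
  (forall i, (1 <= i <= alpha)%N -> set_transform alpha beta th B i c = 0) ->
  (forall i, (1 <= i <= alpha)%N -> set_transform alpha beta th B i c' = 0) ->
  B (st_class alpha beta c') c = 0.
Proof.
move=> hb hc' hc th1 lk Z Z'.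
have := st_class_bounds hb hc'; have := st_class_bounds hb hc.
move: lk; rewrite /st_linked /st_class.
case: (leqP c' (2 * alpha - beta)%N) => hm'.
- case: (leqP c (2 * alpha - beta)%N) => hm /= e bc bc'.
  + move: (Z _ bc') (Z' _ bc); rewrite /set_transform /= hm hm'.
    case: ltngtP => h; rewrite ?h // => e1 e2; first by have [] := pair_solve (th1 _ _) e1 e2.
    by have [] := pair_solve (th1 _ _) e2 e1.
  + move: (Z _ bc'); rewrite /set_transform /= (leqNgt c (2 * alpha - beta)) hm hm' /=.
    by rewrite (negPf e).
- case/andP => hm /eqP e; rewrite (leqNgt c (2 * alpha - beta)) hm /= => bc bc'.
  move: (Z _ bc') (Z' _ bc); rewrite /set_transform /=.
  rewrite (leqNgt c (2 * alpha - beta)) hm (leqNgt c' (2 * alpha - beta)) hm' /= e.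
  have -> : (2 * alpha - beta + (c' - (2 * alpha - beta)).+1./2 <= 2 * alpha - beta)%N = false by lia.
  have -> : (2 * alpha - beta + (c - (2 * alpha - beta)).+1./2 <= 2 * alpha - beta)%N = false by lia.
  rewrite (_ : (if odd _ then _ else _) = c'); last by rewrite /st_c1 /st_c2; case: ifP; lia.
  rewrite (_ : (if odd _ then _ else _) = c); last by rewrite /st_c1 /st_c2; case: ifP; lia.
  case: ltngtP => h e1 e2; first by have [] := pair_solve (th1 _ _) e2 e1.
    by have [] := pair_solve (th1 _ _) e1 e2.
  exact: e1.
Qed.

(** A guard column stores the partner of the symbol at [(i, j)], and the two symbols form the system
    of [pair_solve]. *)
Lemma st_guard_slope0 (F : fieldType) (alpha beta : nat)
    (th B : nat -> nat -> F) i j :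
  (alpha <= beta < 2 * alpha)%N ->
  (1 <= i <= alpha)%N -> (1 <= j <= beta)%N -> (forall i j, th i j != 1) ->
  (forall c i', c \in j :: st_guard alpha beta i j -> (1 <= i' <= alpha)%N ->
     set_transform alpha beta th B i' c = 0) ->
  st_slope alpha beta B i j = 0.
Proof.
move=> hb hi hj th1; case: (leqP i (st_class alpha beta j)) => [h _|].
  exact: st_slope_trivial.
have := st_class_bounds hb hj; rewrite /st_class /st_guard /st_slope /=.
case: (leqP j (2 * alpha - beta)%N) => hm bj lt Z; case: (leqP i (2 * alpha - beta)%N) => him.
- rewrite lt; move: (Z j i); rewrite him !inE eqxx => /(_ isT hi).
  move: (Z i j); rewrite him !inE eqxx orbT => /(_ isT bj).
  rewrite /set_transform /= him hm lt ltnNge (ltnW lt) /= eq_sym ifF ?ltn_eqF // => e1 e2.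
  by have [] := pair_solve (th1 _ _) e1 e2.
- move: (Z j i) (Z (st_c1 alpha beta i) j) (Z (st_c2 alpha beta i) j).
  rewrite (leqNgt i (2 * alpha - beta)) him !inE !eqxx !orbT /= => /(_ isT hi) + /(_ isT bj) + /(_ isT bj).
  rewrite /set_transform /= hm (leqNgt i (2 * alpha - beta)) him /= ifF; last by rewrite /st_c1; lia.
  rewrite ifT; last by rewrite /st_c1; lia.
  rewrite (_ : (_ + _./2)%N = i); last by rewrite /st_c1; lia.
  rewrite ifF; last by rewrite /st_c2; lia.
  rewrite ifF; last by rewrite /st_c2; lia.
  (* Region (B2): column [c2] stores its entry of row [j] unmixed, so only the pair formed with
     column [c1] is left to solve. *)
  move=> e0 e1 e2; move: e0; rewrite e2 addr0 => e0.
  by have [] := pair_solve (th1 _ _) e1 e0.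
- lia.
- rewrite lt; set ci := if _ then _ else _.
  have eci : ci = (2 * i + beta - 2 * alpha - odd (j - (2 * alpha - beta)))%N.
    by rewrite /ci /st_c1 /st_c2; case: ifP; lia.
  move: (Z j i) (Z ci (2 * alpha - beta + (j - (2 * alpha - beta)).+1./2)%N).
  rewrite !inE !eqxx orbT => /(_ isT hi) + /(_ isT bj).
  rewrite /set_transform /= (leqNgt j (2 * alpha - beta)) hm (leqNgt i (2 * alpha - beta)) him /= lt -/ci.
  rewrite ifF; last by lia. rewrite ifF; last by lia.
  rewrite (_ : (_ + (ci - _).+1./2)%N = i); last by lia.
  rewrite ltnNge (ltnW lt) /= ifF; last by lia.
  rewrite (_ : odd (ci - _) = odd (j - (2 * alpha - beta))); last by lia.
  rewrite (_ : (if odd _ then _ else _) = j); last by rewrite /st_c1 /st_c2; case: ifP; lia.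
  move=> e1 e2. by have [] := pair_solve (th1 _ _) e2 e1.
Qed.

(** A term added without a coefficient always comes from a row of larger index; the other added
    terms vanish with the coefficients. *)
Lemma set_transform0_lower (F : fieldType) (alpha beta : nat)
    (B : nat -> nat -> F) i j :
  (alpha <= beta < 2 * alpha)%N -> (1 <= i <= alpha)%N -> (1 <= j <= beta)%N ->
  (forall r c, (i < r <= alpha)%N -> (1 <= c)%N -> B r c = 0) ->
  set_transform alpha beta (fun _ _ => 0) B i j = B i j.
Proof.
move=> hb hi hj H; rewrite /set_transform /=.
case: (leqP j (2 * alpha - beta)%N) => hm; case: (leqP i (2 * alpha - beta)%N) => him; rewrite ?mul0r ?addr0 //.
- case: (ltngtP i j) => [h|h|->]; rewrite ?mul0r ?addr0 // [X in _ + X]H ?addr0 //; lia.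
- case: ifP => // _; rewrite [X in _ + X]H ?addr0 //; lia.
- case: ltngtP => h; rewrite ?mul0r ?addr0 // [X in _ + X]H ?addr0 //; first lia.
  by rewrite /st_c1 /st_c2; case: ifP; lia.
Qed.

(** * The base code and the blocks of columns *)

Definition injective_points {F : fieldType} (n : nat) (x : nat -> F) : Prop :=
  forall u v, (1 <= u <= n)%N -> (1 <= v <= n)%N -> x u = x v -> u = v.

Lemma base_array_comb (F : fieldType) k (x : nat -> F) (d d' : nat -> nat -> F)
    (a a' : F) i j :
  base_array k x (fun i j => a * d i j + a' * d' i j) i j =
  a * base_array k x d i j + a' * base_array k x d' i j.
Proof.
rewrite /base_array /lagrange_eval; case: ifP => // _.
by rewrite !mulr_sumr -big_split /=; apply: eq_bigr => t _; ring.
Qed.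

Lemma base_array_row0 (F : fieldType) k (x : nat -> F) (d : nat -> nat -> F) i j :
  (forall t, (1 <= t <= k)%N -> d i t = 0) -> (1 <= j)%N ->
  base_array k x d i j = 0.
Proof.
move=> d0 j1; rewrite /base_array; case: ifP => hj; first by apply: d0; lia.
rewrite /lagrange_eval big_nat_cond big1 // => t /andP[ht _].
by rewrite d0 ?mul0r //; lia.
Qed.

(** The polynomial is the Lagrange interpolant: each basis polynomial has [k - 1] factors, and at a
    systematic point only one of them is nonzero. *)
Lemma base_array_poly (F : fieldType) n k (x : nat -> F) (d : nat -> nat -> F) i :
  injective_points n x -> (k <= n)%N ->
  exists2 p : {poly F}, (size p <= k)%N &
    forall j, (1 <= j <= n)%N -> base_array k x d i j = p.[x j].
Proof.
move=> xI kn.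
pose p : {poly F} := \sum_(1 <= t < k.+1) d i t *:
  \prod_(1 <= u < k.+1 | u != t) ((x t - x u)^-1 *: ('X - (x u)%:P)).
have pE y : p.[y] = lagrange_eval k x (d i) y.
  rewrite horner_sum; apply: eq_bigr => t _; rewrite hornerZ horner_prod.
  by congr (_ * _); apply: eq_bigr => u _; rewrite hornerZ hornerXsubC mulrC.
exists p.
  rewrite /p big_nat_cond; apply: (big_ind (fun q : {poly F} => size q <= k)%N).
  - by rewrite size_poly0.
  - by move=> q r hq hr; rewrite (leq_trans (size_polyD _ _)) // geq_max hq.
  - move=> t /andP[/andP[t1 tk] _]; rewrite (leq_trans (size_scale_leq _ _)) //.
    have -> : \prod_(1 <= u < k.+1 | u != t) ((x t - x u)^-1 *: ('X - (x u)%:P)) =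
       (\prod_(1 <= u < k.+1 | u != t) (x t - x u)^-1) *:
          \prod_(u <- [seq u <- index_iota 1 k.+1 | u != t]) ('X - (x u)%:P).
      rewrite big_filter; elim/big_rec3: _ => [|u a b c _ ->]; first by rewrite scale1r.
      by rewrite -scalerAl -scalerAr scalerA.
    rewrite (leq_trans (size_scale_leq _ _)) // size_prod_XsubC size_filter.
    have := count_predC (pred1 t) (index_iota 1 k.+1).
    rewrite size_iota subSS subn0 count_uniq_mem ?iota_uniq //.
    by rewrite mem_index_iota t1 tk /= add1n => {2}<-.
move=> j hj; rewrite pE /base_array; case: leqP => // jk.
have jin : j \in index_iota 1 k.+1 by rewrite mem_index_iota; lia.
rewrite /lagrange_eval (bigD1_seq j jin (iota_uniq _ _)) /=.
rewrite [X in _ + X]big_nat_cond [X in _ + X]big1 ?addr0; last first.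
  move=> t /andP[ht tj]; apply/eqP; rewrite mulf_eq0 prodf_seq_eq0; apply/orP; right.
  apply/hasP; exists j; first by rewrite mem_index_iota; lia.
  by rewrite eq_sym tj subrr mul0r eqxx.
rewrite big_nat_cond big1 ?mulr1 // => u /andP[hu uj]; rewrite divff // subr_eq0.
by apply: contraNneq uj => e; apply/eqP; apply: xI => //; lia.
Qed.

(** A polynomial of size at most [k] with [k] distinct roots vanishes. *)
Lemma base_array_MDS (F : fieldType) n k (x : nat -> F) (d : nat -> nat -> F) i
    (S : {set 'I_n}) :
  injective_points n x -> (k <= n)%N -> #|S| = k ->
  (forall c, c \in S -> base_array k x d i c.+1 = 0) ->
  forall t, (1 <= t <= k)%N -> d i t = 0.
Proof.
move=> xI kn Sk Z t ht; have [p sp pE] := base_array_poly d i xI kn.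
have p0 : p = 0.
  apply: (@roots_geq_poly_eq0 _ _ [seq x c.+1 | c : 'I_n <- enum S]).
  - apply/allP => y /mapP[c]; rewrite mem_enum => /Z cS ->.
    by rewrite /root -pE ?cS //= ltn_ord.
  - rewrite map_inj_in_uniq ?enum_uniq // => u v _ _ /xI e.
    by apply/val_inj/succn_inj/e; rewrite /= ltn_ord.
  - by rewrite size_map -cardE Sk.
have := pE t; rewrite p0 horner0 /base_array => <-; last by lia.
by case/andP: ht => _ ->.
Qed.

Lemma st_width_bounds n alpha b : (1 <= alpha)%N ->
  (alpha <= st_width n alpha b < 2 * alpha)%N.
Proof.
by move=> a0; rewrite /st_width; case: ifP => _; have := ltn_pmod n a0; lia.
Qed.

(** Together with [st_block_split], this identifies the columns [1..n] with the pairs of a block and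
    a local index. *)
Lemma st_block_col n alpha b j : (1 <= alpha <= n)%N ->
  (b < n %/ alpha)%N -> (1 <= j <= st_width n alpha b)%N ->
  (1 <= b * alpha + j <= n)%N /\ st_block n alpha (b * alpha + j) = b.
Proof.
move=> an bL; rewrite /st_width /st_block; have en := divn_eq n alpha.
have a0 : (0 < alpha)%N by lia.
have := ltn_pmod n a0; set r := (n %% alpha)%N in en *; set L := (n %/ alpha)%N in en bL *.
move=> hr; case: eqP => [eb|nb] hj.
  split; first by rewrite en; have := leq_mul2r alpha b.+1 L; rewrite bL orbT; lia.
  rewrite -eb; apply/minn_idPr; rewrite leq_divRL //; lia.
split; first by rewrite en; have := leq_mul2r alpha b.+1 L; rewrite bL orbT; lia.
have -> : ((b * alpha + j).-1 %/ alpha)%N = b.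
  by rewrite (_ : _.-1 = b * alpha + j.-1)%N ?divnMDl // ?divn_small ?addn0 //; lia.
by apply/minn_idPl; lia.
Qed.

Lemma st_block_split n alpha c : (1 <= alpha <= n)%N -> (1 <= c <= n)%N ->
  exists b j, [/\ (b < n %/ alpha)%N, (1 <= j <= st_width n alpha b)%N &
                 c = (b * alpha + j)%N].
Proof.
move=> an hc; have a0 : (0 < alpha)%N by lia.
have L1 : (0 < n %/ alpha)%N by rewrite divn_gt0 //; lia.
have en := divn_eq n alpha; have ec := divn_eq c.-1 alpha.
have := ltn_pmod n a0; have := ltn_pmod c.-1 a0.
rewrite /st_width; set r := (n %% alpha)%N in en *; set L := (n %/ alpha)%N in en L1 *.
set e := (c.-1 %/ alpha)%N in ec *; set s := (c.-1 %% alpha)%N in ec *.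
(* Columns past the first [L - 1] blocks all belong to the last one, whose width absorbs the
   remainder. *)
move=> hs hr; case: (ltnP e L.-1) => he.
  exists e, s.+1; split; [lia| by rewrite ifF; lia | lia].
exists L.-1, (c - L.-1 * alpha)%N; rewrite eqxx.
have h1 : (L.-1 * alpha <= e * alpha)%N by rewrite leq_mul2r he orbT.
have h2 : (L * alpha = L.-1 * alpha + alpha)%N by rewrite -{1}(prednK L1) mulSn addnC.
split; lia.
Qed.

(** Coefficients are handled by row and global column, so that one of them can be changed without
    reference to its block. *)
Definition column_theta {F : fieldType} (alpha : nat) (tau : nat -> nat -> F) :
  nat -> nat -> nat -> F := fun b i j => tau i (b * alpha + j)%N.

Lemma st_rs_codewordE (F : fieldType) n k alpha (x : nat -> F) theta
    (d : nat -> nat -> F) i b j :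
  (1 <= alpha <= n)%N -> (b < n %/ alpha)%N -> (1 <= j <= st_width n alpha b)%N ->
  st_rs_codeword n k alpha x theta d i (b * alpha + j) =
  set_transform alpha (st_width n alpha b) (theta b)
    (fun i' j' => base_array k x d i' (b * alpha + j')%N) i j.
Proof.
move=> an bL hj; rewrite /st_rs_codeword.
by have [_ ->] := st_block_col an bL hj; rewrite addKn.
Qed.

Lemma st_rs_codeword_comb (F : fieldType) n k alpha (x : nat -> F) theta
    (d d' : nat -> nat -> F) (a a' : F) i c :
  st_rs_codeword n k alpha x theta (fun i j => a * d i j + a' * d' i j) i c =
  a * st_rs_codeword n k alpha x theta d i c
    + a' * st_rs_codeword n k alpha x theta d' i c.
Proof.
rewrite /st_rs_codeword -set_transform_comb; congr (set_transform _ _ _ _ _ _).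
by apply/funext => u; apply/funext => v; rewrite base_array_comb.
Qed.

(** * Recovery as triviality of a kernel *)

Definition st_kernel {F : fieldType} n k alpha (x : nat -> F)
    (tau : nat -> nat -> F) (S : {set 'I_n}) (d : nat -> nat -> F) : Prop :=
  forall i (c : 'I_n), (1 <= i <= alpha)%N -> c \in S ->
    st_rs_codeword n k alpha x (column_theta alpha tau) d i c.+1 = 0.

Definition data_zero {F : fieldType} k alpha (d : nat -> nat -> F) : Prop :=
  forall i t, (1 <= i <= alpha)%N -> (1 <= t <= k)%N -> d i t = 0.

Definition recoverable {F : fieldType} n k alpha (x : nat -> F)
    (tau : nat -> nat -> F) (S : {set 'I_n}) : Prop :=
  forall d, st_kernel k alpha x tau S d -> data_zero k alpha d.

Definition codeword_slope {F : fieldType} n k alpha (x : nat -> F)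
    (d : nat -> nat -> F) i c : F :=
  let b := st_block n alpha c in
  st_slope alpha (st_width n alpha b)
    (fun i' j' => base_array k x d i' (b * alpha + j')%N) i (c - b * alpha)%N.

Lemma codeword_slope_comb (F : fieldType) n k alpha (x : nat -> F)
    (d d' : nat -> nat -> F) (a a' : F) i c :
  codeword_slope n k alpha x (fun i j => a * d i j + a' * d' i j) i c =
  a * codeword_slope n k alpha x d i c + a' * codeword_slope n k alpha x d' i c.
Proof.
rewrite /codeword_slope -st_slope_comb; congr (st_slope _ _ _ _ _).
by apply/funext => u; apply/funext => v; rewrite base_array_comb.
Qed.

Lemma codeword_affine (F : fieldType) n k alpha (x : nat -> F)
    (tau tau' : nat -> nat -> F) d i c :
  (1 <= alpha <= n)%N -> (1 <= c <= n)%N ->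
  st_rs_codeword n k alpha x (column_theta alpha tau) d i c =
  st_rs_codeword n k alpha x (column_theta alpha tau') d i c
    + (tau i c - tau' i c) * codeword_slope n k alpha x d i c.
Proof.
move=> an hc; have [b [j [bL hj ec]]] := st_block_split an hc.
rewrite ec /codeword_slope (st_block_col an bL hj).2 addKn !st_rs_codewordE //.
rewrite set_transform_affine [in RHS]set_transform_affine /column_theta; ring.
Qed.

Lemma st_rs_is_MDS_recoverable (F : fieldType) n k alpha (x : nat -> F)
    (tau : nat -> nat -> F) :
  (forall S : {set 'I_n}, #|S| = k -> recoverable k alpha x tau S) ->
  st_rs_is_MDS n k alpha x (column_theta alpha tau).
Proof.
move=> H S Sk d d' e i t hi ht.
apply/eqP; rewrite -subr_eq0; apply/eqP.
(* The difference is put in the two-term shape of [st_rs_codeword_comb]. *)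
have <- : 1 * d i t + (-1) * d' i t = d i t - d' i t by ring.
apply: (H S Sk (fun i j => 1 * d i j + (-1) * d' i j)) => // i' c hi' cS.
by rewrite st_rs_codeword_comb e //; ring.
Qed.

(** * Choosing the coefficients one at a time *)

(* With all coefficients zero, row [i] only receives entries of rows below it,
   so the rows are decoded from the last one upwards. *)
Lemma recoverable0 (F : fieldType) n k alpha (x : nat -> F) (S : {set 'I_n}) :
  injective_points n x -> (k <= n)%N -> (1 <= alpha <= n)%N -> #|S| = k ->
  recoverable k alpha x (fun _ _ => 0) S.
Proof.
move=> xI kn an Sk d Z.
(* Induction on the distance [e] from row [i] to the last row. *)
suff H e i : (i + e = alpha)%N -> (1 <= i)%N ->
    forall t, (1 <= t <= k)%N -> d i t = 0.
  by move=> i t hi; apply: (H (alpha - i)%N); lia.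
elim/ltn_ind: e i => e IH i ei i1.
apply: (base_array_MDS xI kn Sk) => c cS.
have hc : (1 <= c.+1 <= n)%N by rewrite /= ltn_ord.
have hi : (1 <= i <= alpha)%N by lia.
have := Z i c hi cS; have [b [j [bL hj ->]]] := st_block_split an hc.
rewrite st_rs_codewordE // set_transform0_lower //; first exact: st_width_bounds (proj1 (andP an)).
move=> r c' hr hc'; apply: base_array_row0; last by lia.
by apply: (IH (alpha - r)%N); lia.
Qed.

Definition update {F : fieldType} (tau : nat -> nat -> F) (i c : nat) (t : F) : nat -> nat -> F :=
  fun i' c' => if (i' == i) && (c' == c) then t else tau i' c'.

(** A symbol depends on the coefficient of its own position only, and does not change when that
    coefficient multiplies a zero slope. *)
Lemma st_kernel_eq (F : fieldType) n k alpha (x : nat -> F)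
    (tau tau' : nat -> nat -> F) (S : {set 'I_n}) d :
  (1 <= alpha <= n)%N ->
  (forall i (c : 'I_n), (1 <= i <= alpha)%N -> c \in S ->
     (tau i c.+1 - tau' i c.+1) * codeword_slope n k alpha x d i c.+1 = 0) ->
  st_kernel k alpha x tau S d -> st_kernel k alpha x tau' S d.
Proof.
move=> an e Z i c hi cS; rewrite -[RHS](Z i c hi cS).
rewrite [RHS](@codeword_affine _ _ _ _ _ tau tau') ?e ?addr0 //=.
Qed.

(* On the kernel of the remaining symbols the entry at [(i, c)] is
   [u + t * s] with [u] injective, so that kernel is at most a line and a
   single value of [t] kills it. *)
Lemma recoverable_bad_unique (F : fieldType) n k alpha (x : nat -> F)
    (tau : nat -> nat -> F) (S : {set 'I_n}) i (c : 'I_n) t t' :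
  (1 <= alpha <= n)%N -> (1 <= i <= alpha)%N -> c \in S ->
  tau i c.+1 = 0 -> recoverable k alpha x tau S ->
  ~ recoverable k alpha x (update tau i c.+1 t) S ->
  ~ recoverable k alpha x (update tau i c.+1 t') S -> t = t'.
Proof.
move=> an hi cS tau0 R.
(* If [s] fails, then [s] is nonzero and some kernel vector has nonzero slope; otherwise the kernel
   would lie in that of [tau] and be trivial. *)
have bad s : ~ recoverable k alpha x (update tau i c.+1 s) S ->
    exists d, [/\ st_kernel k alpha x (update tau i c.+1 s) S d,
      codeword_slope n k alpha x d i c.+1 != 0 & s != 0].
  move=> nR; apply: contrapT => H; apply: nR => d Kd; apply: R.
  apply: (st_kernel_eq (an) _ (Kd)) => i' c' hi' c'S; rewrite /update.
  case: andP => [[/eqP-> /eqP->]|_]; last by rewrite subrr mul0r.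
  rewrite tau0 subr0; apply/eqP; rewrite mulf_eq0.
  case: (eqVneq s 0) => //= s0; apply: contrapT => /negP sl; apply: H.
  by exists d; split.
have cn : (1 <= c.+1 <= n)%N by rewrite /= ltn_ord.
move=> /bad[d [Kd sd t0]] /bad[d' [Kd' sd' t0']].
pose g e := st_rs_codeword n k alpha x (column_theta alpha tau) e i c.+1.
pose s e := codeword_slope n k alpha x e i c.+1.
have gE e u : st_kernel k alpha x (update tau i c.+1 u) S e -> g e = - (u * s e).
  move=> /(_ i c hi cS); rewrite (@codeword_affine _ _ _ _ _ _ tau) //.
  rewrite /update !eqxx /= tau0 subr0 -/(g e) -/(s e) => /eqP.
  by rewrite addr_eq0 => /eqP.
(* [d] and [d'] are proportional *)
pose e := fun i j => (t' * s d') * d i j + (- (t * s d)) * d' i j.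
have Ke : st_kernel k alpha x tau S e.
  move=> i' c' hi' c'S; rewrite st_rs_codeword_comb.
  have cn' : (1 <= c'.+1 <= n)%N by rewrite /= ltn_ord.
  have [eq|ne] := boolP ((i' == i) && (c'.+1 == c.+1)).
    case/andP: eq => /eqP-> /eqP->; rewrite -/(g d) -/(g d').
    by rewrite (gE _ _ Kd) (gE _ _ Kd'); ring.
  have aux v u : st_kernel k alpha x (update tau i c.+1 u) S v ->
      st_rs_codeword n k alpha x (column_theta alpha tau) v i' c'.+1 = 0.
    move=> /(_ i' c' hi' c'S); rewrite (@codeword_affine _ _ _ _ _ _ tau) //.
    by rewrite /update (negPf ne) subrr mul0r addr0.
  by rewrite (aux _ _ Kd) (aux _ _ Kd'); ring.
(* [e] lies in the kernel for [tau], so its data vanish and its slope with them; this slope equals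
   [(t' - t) * (s d * s d')]. *)
have se0 : s e = 0.
  have e0 := R _ Ke; rewrite /s /codeword_slope.
  have [b [j [bL hj ec]]] := st_block_split an cn.
  rewrite ec (st_block_col an bL hj).2 addKn.
  have hb : (alpha <= st_width n alpha b < 2 * alpha)%N by apply: st_width_bounds; lia.
  apply: st_slope_row0 => // c' hc'; apply: base_array_row0; last by lia.
  by move=> t1 ht1; apply: e0 => //; apply: st_class_bounds.
move: se0; rewrite /s codeword_slope_comb -/(s d) -/(s d') => E.
have /eqP : (t' - t) * (s d * s d') = 0 by rewrite -E; ring.
by rewrite !mulf_eq0 (negPf sd) (negPf sd') /= orbF subr_eq0 => /eqP.
Qed.

(* [S] imposes no condition on the coefficient of row [i], column [c]. *)
Definition protected {F : fieldType} n k alpha (x : nat -> F) i c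
    (S : {set 'I_n}) : Prop :=
  forall (tau : nat -> nat -> F) d, (forall i' c', tau i' c' != 1) ->
    st_kernel k alpha x tau S d -> codeword_slope n k alpha x d i c = 0.

Definition unprotected {F : fieldType} n k alpha (x : nat -> F) i (c : 'I_n) :=
  [set S : {set 'I_n} | [&& #|S| == k, c \in S &
     ~~ `[< protected k alpha x i c.+1 S >]]].

(** Protection only asks the coefficients to avoid 1, so it can be used while the later ones are
    still 0. Sets without [c] do not see the coefficient. *)
Lemma recoverable_protected (F : fieldType) n k alpha (x : nat -> F)
    (tau : nat -> nat -> F) (S : {set 'I_n}) i (c : 'I_n) t :
  (1 <= alpha <= n)%N -> (forall i' c', tau i' c' != 1) -> t != 1 ->
  (c \in S -> protected k alpha x i c.+1 S) ->
  recoverable k alpha x tau S ->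
  recoverable k alpha x (update tau i c.+1 t) S.
Proof.
move=> an tau1 t1 P R d Kd; apply: R; apply: st_kernel_eq an _ (Kd) => i' c' hi' c'S.
have u1 i1 c1 : update tau i c.+1 t i1 c1 != 1 by rewrite /update; case: ifP.
rewrite {1}/update; case: andP => [[/eqP-> /eqP ec]|_]; last by rewrite subrr mul0r.
have ecc : c' = c by apply/val_inj/succn_inj.
by rewrite ec (P _ _ _ u1 Kd) ?mulr0 // -ecc.
Qed.

Lemma recoverable_step (F : finFieldType) n k alpha (x : nat -> F)
    (tau : nat -> nat -> F) i (c : 'I_n) :
  (1 <= alpha <= n)%N -> (1 <= i <= alpha)%N ->
  (forall i' c', tau i' c' != 1) -> tau i c.+1 = 0 ->
  (#|unprotected k alpha x i c| + 2 < #|F|)%N ->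
  (forall S : {set 'I_n}, #|S| = k -> recoverable k alpha x tau S) ->
  exists t, [/\ t != 0, t != 1 & forall S : {set 'I_n}, #|S| = k ->
    recoverable k alpha x (update tau i c.+1 t) S].
Proof.
move=> an hi tau1 tau0 cnt R.
pose bad (S : {set 'I_n}) : {set F} := [set t | ~~ `[< recoverable k alpha x (update tau i c.+1 t) S >]].
pose U := unprotected k alpha x i c.
have bad1 S : S \in U -> (#|bad S| <= 1)%N.
  rewrite inE => /and3P[/eqP Sk cS _].
  apply/card_le1_eqP => t t'; rewrite !inE => /asboolPn h /asboolPn h'.
  exact: (recoverable_bad_unique an hi cS tau0 (R S Sk) h' h).
(* The values to avoid: 0, 1 and, for each unprotected set, at most one value. *)
pose A : {set F} := [set 0; 1] :|: \bigcup_(S in U) bad S.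
have cA : (#|A| < #|F|)%N.
  apply: leq_ltn_trans cnt; rewrite addnC (leq_trans (leq_card_setU _ _)) // leq_add //.
    by rewrite cards2; case: eqP.
  rewrite -[X in (_ <= X)%N]sum1_card; apply: (@leq_trans (\sum_(S in U) #|bad S|)%N); last exact: leq_sum.
  elim/big_rec2: _ => [|S a B _ h]; first by rewrite cards0.
  by rewrite (leq_trans (leq_card_setU _ _)) // leq_add2l.
have [t tA] : exists t, t \notin A.
  apply/existsP; rewrite -negb_forall; apply: contraL cA => /forallP h.
  by rewrite -leqNgt -cardsT subset_leq_card //; apply/fintype.subsetP => t _.
move: tA; rewrite !inE !negb_or => /andP[/andP[t0 t1] tb].
exists t; split=> // S Sk.
have [SU|SU] := boolP (S \in U).
  apply: contrapT => nR; case/negP: tb; apply/bigcupP; exists S => //.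
  by rewrite inE; apply/asboolPn.
apply: recoverable_protected => //; last exact: R.
move=> cS; move: SU; rewrite inE Sk eqxx cS /= negbK => /asboolP; exact.
Qed.

(** Positions outside the list keep their value: in the induction this preserves the coefficients
    already chosen, and it later allows one of them to be fixed beforehand. *)
Lemma recoverable_extend (F : finFieldType) n k alpha (x : nat -> F)
    (ps : seq (nat * 'I_n)) (tau : nat -> nat -> F) :
  (1 <= alpha <= n)%N -> uniq ps ->
  (forall i' c', tau i' c' != 1) ->
  (forall p, p \in ps -> [/\ (1 <= p.1 <= alpha)%N, tau p.1 p.2.+1 = 0 &
     (#|unprotected k alpha x p.1 p.2| + 2 < #|F|)%N]) ->
  (forall S : {set 'I_n}, #|S| = k -> recoverable k alpha x tau S) ->
  exists tau' : nat -> nat -> F, [/\ forall p, p \in ps ->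
      tau' p.1 p.2.+1 != 0 /\ tau' p.1 p.2.+1 != 1,
    forall i (c : 'I_n), (i, c) \notin ps -> tau' i c.+1 = tau i c.+1 &
    forall S : {set 'I_n}, #|S| = k -> recoverable k alpha x tau' S].
Proof.
move=> an; elim: ps tau => [|[i c] ps IH] tau /=; first by exists tau; split.
case/andP=> ips ups tau1 H R.
have [/= hi tau0 cnt] := H (i, c) (mem_head _ _).
have [t [t0 t1 Rt]] := recoverable_step an hi tau1 tau0 cnt R.
case: (IH (update tau i c.+1 t)) => //.
- by move=> i' c'; rewrite /update; case: ifP.
- move=> [i' c'] pin; have [|/= hi' tau0' cnt'] := H (i', c'); first by rewrite inE pin orbT.
  split=> //; rewrite /update ifF //; apply/negP => /andP[/eqP ei /eqP[/val_inj ec]].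
  by rewrite -ei -ec pin in ips.
move=> tau' [h1 h2 h3]; exists tau'; split=> //.
- move=> [i' c']; rewrite inE => /orP[/eqP[-> ->] /=|/h1//].
  by rewrite h2 // /update !eqxx.
- move=> i' c'; rewrite inE negb_or => /andP[ne ni]; rewrite h2 // /update ifF //.
  by apply: contraNF ne => /andP[/eqP-> /eqP[/val_inj->]].
Qed.

(** * Protected sets *)

(** Nodes are ordinals counted from 0 and columns are counted from 1: node [c] stores column
    [c.+1]. *)
Definition col_block n alpha (c : 'I_n) := st_block n alpha c.+1.
Definition col_index n alpha (c : 'I_n) := (c.+1 - col_block alpha c * alpha)%N.
Definition col_width n alpha (c : 'I_n) := st_width n alpha (col_block alpha c).
Definition col_class n alpha (c : 'I_n) :=
  st_class alpha (col_width alpha c) (col_index alpha c).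
(* [c0] is only a default value. *)
Definition mkcol n alpha (c0 : 'I_n) (b j : nat) : 'I_n :=
  insubd c0 (b * alpha + j).-1.
Definition col_linked n alpha (c' c : 'I_n) : bool :=
  (col_block alpha c == col_block alpha c') &&
  st_linked alpha (col_width alpha c) (col_index alpha c') (col_index alpha c).

Lemma col_spec n alpha (c : 'I_n) : (1 <= alpha <= n)%N ->
  [/\ (col_block alpha c < n %/ alpha)%N,
      (1 <= col_index alpha c <= col_width alpha c)%N &
      c.+1 = (col_block alpha c * alpha + col_index alpha c)%N].
Proof.
move=> an; have [|b [j [bL hj ec]]] := @st_block_split n alpha c.+1 an.
  by rewrite /= ltn_ord.
have eb : col_block alpha c = b by rewrite /col_block ec (st_block_col an bL hj).2.
have ej : col_index alpha c = j by rewrite /col_index eb ec addKn.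
by rewrite /col_width eb ej.
Qed.

Lemma mkcol_spec n alpha (c0 : 'I_n) b j : (1 <= alpha <= n)%N ->
  (b < n %/ alpha)%N -> (1 <= j <= st_width n alpha b)%N ->
  [/\ (mkcol alpha c0 b j).+1 = (b * alpha + j)%N,
      col_block alpha (mkcol alpha c0 b j) = b &
      col_index alpha (mkcol alpha c0 b j) = j].
Proof.
move=> an bL hj; have [hc eb] := st_block_col an bL hj.
have ec : (mkcol alpha c0 b j).+1 = (b * alpha + j)%N.
  by rewrite /mkcol val_insubd; case: ltnP => /=; lia.
have eb' : col_block alpha (mkcol alpha c0 b j) = b by rewrite /col_block ec.
by split=> //; rewrite /col_index eb' ec addKn.
Qed.

Lemma col_inj n alpha (c c' : 'I_n) : (1 <= alpha <= n)%N ->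
  col_block alpha c = col_block alpha c' ->
  col_index alpha c = col_index alpha c' -> c = c'.
Proof.
move=> an eb ej; apply/val_inj/succn_inj.
by have [_ _ ->] := col_spec c an; have [_ _ ->] := col_spec c' an; rewrite eb ej.
Qed.

Lemma col_width_bounds n alpha (c : 'I_n) : (1 <= alpha <= n)%N ->
  (alpha <= col_width alpha c < 2 * alpha)%N.
Proof. by move=> an; apply: st_width_bounds; lia. Qed.

Lemma col_linked_refl n alpha (c : 'I_n) : col_linked alpha c c.
Proof.
rewrite /col_linked /st_linked eqxx /=.
by case: (leqP (col_index alpha c)) => //= _.
Qed.

Lemma st_kernel_block (F : fieldType) n k alpha (x : nat -> F) tau
    (S : {set 'I_n}) d (c : 'I_n) i :
  (1 <= alpha <= n)%N -> st_kernel k alpha x tau S d -> c \in S ->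
  (1 <= i <= alpha)%N ->
  set_transform alpha (col_width alpha c)
    (fun i j => tau i (col_block alpha c * alpha + j)%N)
    (fun i' j' => base_array k x d i' (col_block alpha c * alpha + j')%N)
    i (col_index alpha c) = 0.
Proof.
move=> an Kd cS hi; have [bL hj ec] := col_spec c an.
by have := Kd i c hi cS; rewrite {1}ec st_rs_codewordE.
Qed.

Lemma codeword_slopeE (F : fieldType) n k alpha (x : nat -> F) d i (c : 'I_n) :
  (1 <= alpha <= n)%N ->
  codeword_slope n k alpha x d i c.+1 =
  st_slope alpha (col_width alpha c)
    (fun i' j' => base_array k x d i' (col_block alpha c * alpha + j')%N)
    i (col_index alpha c).
Proof. by []. Qed.

Lemma protected_guard (F : fieldType) n k alpha (x : nat -> F) i (c : 'I_n)
    (S : {set 'I_n}) :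
  (1 <= alpha <= n)%N -> (1 <= i <= alpha)%N -> c \in S ->
  (forall g, g \in st_guard alpha (col_width alpha c) i (col_index alpha c) ->
     (1 <= g <= col_width alpha c)%N /\
     mkcol alpha c (col_block alpha c) g \in S) ->
  protected k alpha x i c.+1 S.
Proof.
move=> an hi cS G tau d tau1 Kd; have [bL hj ec] := col_spec c an.
rewrite codeword_slopeE //.
apply: (@st_guard_slope0 _ _ _
  (fun i j => tau i (col_block alpha c * alpha + j)%N)) => //.
  exact: col_width_bounds.
move=> g i'; rewrite inE => /orP[/eqP-> | /G[hg gS]] hi'.
  exact: st_kernel_block Kd cS hi'.
have [_ eb ej] := mkcol_spec c an bL hg.
by have := st_kernel_block an Kd gS hi'; rewrite /col_width eb ej.
Qed.

(** Each node of [S] yields one symbol of row [col_class alpha c] of the base array. These [k]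
    symbols determine the row, which contains all terms of the slope. *)
Lemma protected_row (F : fieldType) n k alpha (x : nat -> F) i (c : 'I_n)
    (S : {set 'I_n}) :
  injective_points n x -> (k <= n)%N ->
  (1 <= alpha <= n)%N -> (1 <= i <= alpha)%N -> #|S| = k ->
  (forall o, o \in S -> exists2 o', o' \in S &
     col_class alpha o' = col_class alpha c /\ col_linked alpha o' o) ->
  protected k alpha x i c.+1 S.
Proof.
move=> xI kn an hi Sk H tau d tau1 Kd.
have [bL hj ec] := col_spec c an; have hw := col_width_bounds c an.
suff Z : forall t, (1 <= t <= k)%N -> d (col_class alpha c) t = 0.
  rewrite codeword_slopeE //; apply: st_slope_row0 => // c' hc'.
  by apply: base_array_row0 => //; lia.
apply: (base_array_MDS xI kn Sk) => o oS.
have [o' o'S [<- /andP[/eqP eb lk]]] := H o oS.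
have [bLo hjo eco] := col_spec o an; have [bLo' hjo' eco'] := col_spec o' an.
have ew : col_width alpha o' = col_width alpha o by rewrite /col_width eb.
rewrite {1}eco /col_class ew.
apply: (@st_linked_zero _ _ _ (fun i j => tau i (col_block alpha o * alpha + j)%N)
  (fun i' j' => base_array k x d i' (col_block alpha o * alpha + j')%N)) => //.
- exact: col_width_bounds.
- by rewrite -ew.
- by move=> i' hi'; exact: st_kernel_block an Kd oS hi'.
- by move=> i' hi'; rewrite eb -ew; exact: st_kernel_block an Kd o'S hi'.
Qed.

(** * Families of protected sets and their sizes *)

Lemma card_between (T : finType) (G N : {set T}) k :
  [disjoint G & N] -> (#|G| <= k)%N ->
  #|[set S : {set T} | [&& G \subset S, S \subset G :|: N & #|S| == k]]|
    = 'C(#|N|, k - #|G|).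
Proof.
move=> dGN Gk; rewrite -cards_draws.
rewrite -(card_in_imset (f := fun A => G :|: A)
   (D := [set A : {set T} | A \subset N & #|A| == (k - #|G|)%N])).
- apply/esym; congr #|pred_of_set _|; apply/setP => S; rewrite inE.
  apply/imsetP/and3P => [[A]|[GS SN Sk]].
    rewrite inE => /andP[AN /eqP Ak] ->; rewrite subsetUl setUS //; split=> //.
    rewrite cardsU Ak disjoint_setI0 ?cards0 ?subn0 ?subnKC //.
    by apply: disjointWr dGN.
  have eS : G :|: S :\: G = S by rewrite -{1}(setIidPr GS) setID.
  exists (S :\: G) => //; rewrite inE cardsDS // (eqP Sk) eqxx andbT.
  by rewrite subDset.
- move=> A B; rewrite !inE => /andP[AN _] /andP[BN _] e.
  have aux (C : {set T}) : C \subset N -> (G :|: C) :\: G = C.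
    move=> CN; rewrite setDUl setDv set0U; apply/setDidPl.
    by rewrite disjoint_sym; apply: disjointWr dGN.
  by rewrite -(aux A AN) e aux.
Qed.

(** ['C(n.-1, k.-1)] is the number of [k]-sets containing [c], and [X] is disjoint from the
    unprotected ones. *)
Lemma unprotected_le (F : fieldType) n k alpha (x : nat -> F) i (c : 'I_n)
    (X : {set {set 'I_n}}) :
  (1 <= k)%N ->
  (forall S, S \in X -> [/\ #|S| = k, c \in S & protected k alpha x i c.+1 S]) ->
  (#|unprotected k alpha x i c| + #|X| <= 'C(n.-1, k.-1))%N.
Proof.
move=> k1 H.
have dc : [disjoint [set c] & ~: [set c]] by rewrite -setI_eq0 setICr.
have := card_between dc (_ : (#|[set c]| <= k)%N); rewrite cards1 => /(_ k1).
rewrite cardsC1 card_ord subn1 => <-.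
have dX : unprotected k alpha x i c :&: X = set0.
  apply/setP => S; rewrite !inE; apply/negP => /andP[/and3P[_ _ /asboolPn nP] /H[_ _]].
  exact: nP.
have -> : (#|unprotected k alpha x i c| + #|X|)%N = #|unprotected k alpha x i c :|: X|.
  by rewrite cardsU dX cards0 subn0.
apply: subset_leq_card; apply/fintype.subsetP => S.
rewrite !inE setUCr subsetT sub1set /= => /orP[/and3P[-> -> _] // | /H[-> -> _]].
by rewrite eqxx.
Qed.

(** The nodes that can join [c] while keeping the hypothesis of [protected_row]: those of its class
    are linked to themselves, the others to [c]. *)
Definition row_cols n alpha (c : 'I_n) : {set 'I_n} :=
  [set o | (o != c) && ((col_class alpha o == col_class alpha c)
                        || col_linked alpha c o)].

Lemma protected_row_cols (F : fieldType) n k alpha (x : nat -> F) i (c : 'I_n)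
    (S : {set 'I_n}) :
  injective_points n x -> (k <= n)%N ->
  (1 <= alpha <= n)%N -> (1 <= i <= alpha)%N -> #|S| = k ->
  c \in S -> S \subset [set c] :|: row_cols alpha c ->
  protected k alpha x i c.+1 S.
Proof.
move=> xI kn an hi Sk cS SN; apply: protected_row => // o oS.
have := fintype.subsetP SN o oS; rewrite !inE => /orP[/eqP->|/andP[_ /orP[/eqP e|lk]]].
- by exists c => //; split=> //; apply: col_linked_refl.
- by exists o => //; split=> //; apply: col_linked_refl.
- by exists c.
Qed.

(** A representative of class [w] in block [b]. Of the two columns of a class beyond [m] the second
    is taken, since it is linked to each of the first [m] columns. *)
Definition class_col n alpha (c0 : 'I_n) (b w : nat) : 'I_n :=
  let beta := st_width n alpha b in
  mkcol alpha c0 b (if (w <= 2 * alpha - beta)%N then w else st_c2 alpha beta w).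

Lemma class_col_spec n alpha (c0 : 'I_n) b w : (1 <= alpha <= n)%N ->
  (b < n %/ alpha)%N -> (1 <= w <= alpha)%N ->
  [/\ col_block alpha (class_col alpha c0 b w) = b,
      col_class alpha (class_col alpha c0 b w) = w &
      forall c, col_block alpha c = b ->
        (col_index alpha c <= 2 * alpha - st_width n alpha b)%N ->
        col_linked alpha c (class_col alpha c0 b w)].
Proof.
move=> an bL hw; have hb : (alpha <= st_width n alpha b < 2 * alpha)%N.
  by apply: st_width_bounds; lia.
rewrite /class_col; set g := if _ then _ else _.
have hg : (1 <= g <= st_width n alpha b)%N.
  by rewrite /g /st_c2; case: ifP; lia.
have [_ eb ej] := mkcol_spec c0 an bL hg; split=> //.
  by rewrite /col_class /col_width eb ej /st_class /g /st_c2; do ![case: ifP]; lia.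
move=> c ebc hc; rewrite /col_linked /col_width eb ebc eqxx ej /= /st_linked hc.
by rewrite /g /st_c2; case: ifP; lia.
Qed.

Lemma class_col_inj n alpha (c0 : 'I_n) b w b' w' : (1 <= alpha <= n)%N ->
  (b < n %/ alpha)%N -> (1 <= w <= alpha)%N ->
  (b' < n %/ alpha)%N -> (1 <= w' <= alpha)%N ->
  class_col alpha c0 b w = class_col alpha c0 b' w' -> b = b' /\ w = w'.
Proof.
move=> an hb hw hb' hw' e.
have [eb ew _] := class_col_spec c0 an hb hw; have [eb' ew' _] := class_col_spec c0 an hb' hw'.
by split; [rewrite -eb e eb' | rewrite -ew e ew'].
Qed.

Lemma class_col_low n alpha (c c0 : 'I_n) : (1 <= alpha <= n)%N ->
  (col_index alpha c <= 2 * alpha - col_width alpha c)%N ->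
  class_col alpha c0 (col_block alpha c) (col_index alpha c) = c.
Proof.
move=> an hc; have [bL hj _] := col_spec c an.
have [_ eb ej] := mkcol_spec c0 an bL hj.
by rewrite /class_col hc; apply: (col_inj an).
Qed.

(** As [c] is among the first [m] columns of its block, it is linked to a representative of each of
    the [alpha - 1] other classes there; each of the [n %/ alpha - 1] other blocks contributes a
    node of the class of [c]. *)
Lemma card_row_cols_low n alpha (c : 'I_n) : (1 <= alpha <= n)%N ->
  (col_index alpha c <= 2 * alpha - col_width alpha c)%N ->
  (alpha + n %/ alpha - 2 <= #|row_cols alpha c|)%N.
Proof.
move=> an hc; have [bL hj _] := col_spec c an; have hw := col_width_bounds c an.
set b := col_block alpha c in bL; set j := col_index alpha c in hc hj.
have cj : col_class alpha c = j by rewrite /col_class /st_class hc.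
have ec := class_col_low c an hc; rewrite -/b -/j in ec.
have ja : (1 <= j <= alpha)%N by lia.
pose P := [seq (b, w) | w <- iota 1 alpha & w != j] ++
          [seq (b', j) | b' <- iota 0 (n %/ alpha) & b' != b].
have Pin p : p \in P -> [/\ (p.1 < n %/ alpha)%N, (1 <= p.2 <= alpha)%N,
    p != (b, j) & (p.1 == b) || (p.2 == j)].
  rewrite mem_cat => /orP[] /mapP[w]; rewrite mem_filter mem_iota => /andP[ne hin] -> /=;
  split; rewrite ?eqxx ?orbT //; try lia;
  by rewrite xpair_eqE negb_and ne ?orbT.
have sP : size P = (alpha + n %/ alpha - 2)%N.
  have aux a l q : q \in iota a l -> size [seq w <- iota a l | w != q] = l.-1.
    move=> qin; have := count_predC (pred1 q) (iota a l).
    by rewrite count_uniq_mem ?iota_uniq // qin size_iota size_filter add1n => e; rewrite -[in RHS]e.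
  by rewrite size_cat !size_map !aux ?mem_iota; lia.
pose f p := class_col alpha c p.1 p.2.
have uP : uniq P.
  rewrite cat_uniq !map_inj_uniq ?filter_uniq ?iota_uniq //= ?andbT; last first.
  - by move=> ? ? [].
  - by move=> ? ? [].
  apply/hasPn => p /mapP[b']; rewrite mem_filter => /andP[nb _] ->.
  by apply/negP => /mapP[w _ [eb _]]; rewrite eb eqxx in nb.
rewrite -sP -(size_map f).
have uf : uniq [seq f p | p <- P].
  rewrite map_inj_in_uniq // => -[b1 w1] [b2 w2] /Pin[/= h1 h2 _ _] /Pin[/= h3 h4 _ _] e.
  by have [-> ->] := class_col_inj an h1 h2 h3 h4 e.
rewrite -(card_uniqP uf); apply: subset_leq_card; apply/fintype.subsetP => o.
case/mapP => -[b1 w1] /Pin[/= h1 h2 h3 h4] ->; rewrite inE /f /=.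
have [eb ew lk] := class_col_spec c an h1 h2.
apply/andP; split.
  apply: contraNneq h3 => e; rewrite -[RHS]ec in e.
  by have [-> ->] := class_col_inj an h1 h2 bL ja e.
case/orP: h4 => /eqP e; last by rewrite ew cj e eqxx.
by rewrite lk ?orbT // e.
Qed.

Lemma card_row_cols_high n alpha (c : 'I_n) i : (1 <= alpha <= n)%N ->
  (2 * alpha - col_width alpha c < col_index alpha c)%N ->
  (col_class alpha c < i <= alpha)%N ->
  (2 <= #|row_cols alpha c|)%N.
Proof.
move=> an hc hi; have [bL hj _] := col_spec c an; have hw := col_width_bounds c an.
move: hi; rewrite /col_class /st_class ifF => [hi|]; last by lia.
set b := col_block alpha c in bL; set j := col_index alpha c in hc hj hi.
set beta := col_width alpha c in hc hj hw hi.
(* [g1] is the other column of the class of [c]; [g2] is the column of class [i] with the parity of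
   [c], hence linked to [c]. *)
pose g1 := if odd (j - (2 * alpha - beta)) then j.+1 else j.-1.
pose g2 := if odd (j - (2 * alpha - beta)) then st_c1 alpha beta i else st_c2 alpha beta i.
have h1 : (1 <= g1 <= beta)%N by rewrite /g1; case: ifP; lia.
have h2 : (1 <= g2 <= beta)%N by rewrite /g2 /st_c1 /st_c2; case: ifP; lia.
have [_ eb1 ej1] := mkcol_spec c an bL h1; have [_ eb2 ej2] := mkcol_spec c an bL h2.
have g12 : g1 != g2 by rewrite /g1 /g2 /st_c1 /st_c2; case: ifP; lia.
have g1j : g1 != j by rewrite /g1; case: ifP; lia.
have g2j : g2 != j by rewrite /g2 /st_c1 /st_c2; case: ifP; lia.
have ne : mkcol alpha c b g1 != mkcol alpha c b g2.
  by apply: contraNneq g12 => e; rewrite -ej1 e ej2.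
apply: (@leq_trans #|[set mkcol alpha c b g1; mkcol alpha c b g2]|); first by rewrite cards2 ne.
apply: subset_leq_card; apply/fintype.subsetP => o; rewrite !inE => /orP[] /eqP->.
- apply/andP; split; first by apply: contraNneq g1j => e; rewrite -ej1 e.
  apply/orP; left; rewrite /col_class /col_width eb1 ej1 -/(col_width _ _) -/beta -/j.
  by rewrite /st_class /g1; do ![case: ifP]; lia.
- apply/andP; split; first by apply: contraNneq g2j => e; rewrite -ej2 e.
  apply/orP; right; rewrite /col_linked /col_width eb2 eqxx ej2 -/(col_width _ _) -/beta -/j.
  by rewrite /st_linked /g2 /st_c1 /st_c2; do ![case: ifP]; lia.
Qed.

(** * Comparison of binomial coefficients and of ceilings *)

Lemma leq_bin_mono a b s t : ('C(a, b) <= 'C(a + s + t, b + t))%N.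
Proof.
elim: t => [|t IH]; last by rewrite !addnS binS (leq_trans IH) // leq_addl.
by rewrite !addn0; apply: leq_bin2l; rewrite leq_addr.
Qed.

(** A binomial coefficient grows with [a - b] when [b] is fixed and, by Pascal's rule, with [b] when
    [a - b] is fixed. *)
Lemma leq_bin_diag a b a' b' : (b <= a)%N -> (b <= b')%N ->
  (a - b <= a' - b')%N -> (b' <= a')%N -> ('C(a, b) <= 'C(a', b'))%N.
Proof.
move=> h1 h2 h3 h4; have := leq_bin_mono a b (a' - b' - (a - b)) (b' - b).
have -> : (a + (a' - b' - (a - b)) + (b' - b))%N = a' by lia.
by have -> : (b + (b' - b))%N = b' by lia.
Qed.

Lemma ceil_div_bounds a b : (1 <= b)%N ->
  (a <= ceil_div a b * b)%N /\ (ceil_div a b * b < a + b)%N.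
Proof.
move=> b1; have := divn_eq (a + b.-1) b; have := ltn_pmod (a + b.-1) b1.
by rewrite /ceil_div; set q := (_ %/ _)%N; lia.
Qed.

(** These inequalities feed [leq_bin_diag] when the subtracted binomial coefficient is compared with
    one of upper index [n - 3] or [n - 4]. *)
Lemma ceil_div_gap n k alpha : (1 <= k)%N -> (2 <= alpha)%N ->
  (k + alpha <= n)%N ->
  [/\ (1 <= ceil_div k alpha < ceil_div n alpha)%N,
      (ceil_div n alpha - ceil_div k alpha < n - k)%N &
      (2 * ceil_div k alpha <= k.+1)%N].
Proof.
move=> k1 a2 nk; have a1 : (1 <= alpha)%N by lia.
have [kl ku] := ceil_div_bounds k a1; have [nl nu] := ceil_div_bounds n a1.
set K := ceil_div k alpha in kl ku *; set N := ceil_div n alpha in nl nu *.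
have K1 : (1 <= K)%N by rewrite lt0n; apply/eqP => K0; rewrite K0 in kl; lia.
have KN : (K < N)%N.
  by rewrite ltnNge; apply/negP => h; have := leq_mul2r alpha N K; rewrite h orbT; lia.
split; first by rewrite K1.
  have e : (N = K.+1 + (N - K.+1))%N by lia.
  move: nu; rewrite e mulnDl mulSn; set z := (N - K.+1)%N.
  have : (z * 2 <= z * alpha)%N by rewrite leq_mul2l a2 orbT.
  rewrite -e; lia.
have e : (K = 1 + K.-1)%N by lia.
move: ku; rewrite e mulnDl; set z := K.-1.
have : (z * 2 <= z * alpha)%N by rewrite leq_mul2l a2 orbT.
lia.
Qed.

(** The last hypothesis excludes region (B2), so the slope is a single entry and one guard column
    suffices. *)
Lemma two_column_guard (F : fieldType) n k alpha (x : nat -> F) i (c : 'I_n) :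
  (1 <= alpha <= n)%N -> (col_class alpha c < i <= alpha)%N ->
  ((col_index alpha c <= 2 * alpha - col_width alpha c)%N ->
     (i <= 2 * alpha - col_width alpha c)%N) ->
  exists g : 'I_n, [/\ g != c, col_block alpha g = col_block alpha c &
    forall S : {set 'I_n}, c \in S -> g \in S -> protected k alpha x i c.+1 S].
Proof.
move=> an hi low; have [bL hj _] := col_spec c an; have hw := col_width_bounds c an.
pose g := if (i <= 2 * alpha - col_width alpha c)%N then i else
  if odd (col_index alpha c - (2 * alpha - col_width alpha c))
  then st_c1 alpha (col_width alpha c) i else st_c2 alpha (col_width alpha c) i.
have [eg hg gj] : [/\ st_guard alpha (col_width alpha c) i (col_index alpha c) = [:: g],
    (1 <= g <= col_width alpha c)%N & g != col_index alpha c].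
  move: hi low hj hw; rewrite /g /st_guard /st_c1 /st_c2 /col_class /st_class.
  set j := col_index alpha c; set beta := col_width alpha c.
  case: (leqP j (2 * alpha - beta)%N) => h1.
    by move=> h2 /(_ isT) h3; rewrite h3 => h4 h5; split=> //; lia.
  move=> h2 _ h4 h5; have -> : (i <= 2 * alpha - beta)%N = false by lia.
  by split=> //; case: ifP; lia.
have [_ eb ej] := mkcol_spec c an bL hg.
exists (mkcol alpha c (col_block alpha c) g); split=> //.
  by apply: contraNneq gj => e; rewrite -ej e.
move=> S cS gS; apply: protected_guard => //; first by lia.
by move=> g'; rewrite eg inE => /eqP->.
Qed.

(** In region (B2) the slope is a sum of two entries, hence two guards. As [g], the [c1] column,
    lies outside [row_cols], the sets obtained here differ from those contained in [c] and
    [row_cols]. *)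
Lemma three_column_guard (F : fieldType) n k alpha (x : nat -> F) i (c : 'I_n) :
  (1 <= alpha <= n)%N -> (1 <= i <= alpha)%N ->
  (col_index alpha c <= 2 * alpha - col_width alpha c < i)%N ->
  exists g g' : 'I_n, [/\ uniq [:: c; g; g'],
    col_block alpha g = col_block alpha c, g \notin row_cols alpha c &
    forall S : {set 'I_n}, c \in S -> g \in S -> g' \in S -> protected k alpha x i c.+1 S].
Proof.
move=> an hi /andP[hj' him]; have [bL hj _] := col_spec c an.
have hw := col_width_bounds c an.
set beta := col_width alpha c in hj hj' him hw; set j := col_index alpha c in hj hj'.
have h1 : (1 <= st_c1 alpha beta i <= beta)%N by rewrite /st_c1; lia.
have h2 : (1 <= st_c2 alpha beta i <= beta)%N by rewrite /st_c2; lia.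
have [_ eb1 ej1] := mkcol_spec c an bL h1; have [_ eb2 ej2] := mkcol_spec c an bL h2.
exists (mkcol alpha c (col_block alpha c) (st_c1 alpha beta i)),
       (mkcol alpha c (col_block alpha c) (st_c2 alpha beta i)); split=> //.
- rewrite /= !inE negb_or andbT -!andbA; apply/and3P; split; apply/eqP => e.
  + by move: ej1; rewrite -e -/j /st_c1; lia.
  + by move: ej2; rewrite -e -/j /st_c2; lia.
  + by move: ej1; rewrite e ej2 /st_c1 /st_c2; lia.
- rewrite inE negb_and negb_or; apply/orP; right.
  rewrite /col_class /col_linked /col_width eb1 ej1 eqxx -/(col_width _ _) -/beta -/j.
  rewrite /st_class /st_linked hj' ifF; last by rewrite /st_c1; lia.
  by rewrite /= /st_c1; lia.
- move=> S cS gS g'S; apply: protected_guard => // g.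
  rewrite /st_guard -/beta -/j hj' ifF; last by lia.
  by rewrite !inE => /orP[] /eqP->.
Qed.

(** The set consists of [c] and of one node of each class, [u] and [v], in another block. It decodes
    row 1: [c] and [u] store their entry unmixed and [v] is linked to [u]. The clauses on [row_cols]
    and on blocks ensure that this set is not counted twice. *)
Lemma extra_protected (F : fieldType) n (x : nat -> F) i (c : 'I_n) :
  injective_points n x -> (4 <= n)%N -> (1 <= i <= 2)%N -> col_class 2 c = 1%N ->
  exists S : {set 'I_n}, [/\ #|S| = 3%N, c \in S,
    ~~ (S \subset [set c] :|: row_cols 2 c),
    forall o, o \in S -> col_block 2 o = col_block 2 c -> o = c &
    protected 3 2 x i c.+1 S].
Proof.
move=> xI n4 hi cc; have an : (1 <= 2 <= n)%N by lia.
have [bL hj _] := col_spec c an.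
have [b' b'L b'b] : exists2 b', (b' < n %/ 2)%N & b' != col_block 2 c.
  by case: (eqVneq (col_block 2 c) 0%N) => h; [exists 1%N | exists 0%N];
    rewrite ?h //; lia.
have [eb1 ec1 _] := class_col_spec c an b'L (isT : (1 <= 1 <= 2)%N).
have [eb2 ec2 lk] := class_col_spec c an b'L (isT : (1 <= 2 <= 2)%N).
set u := class_col 2 c b' 1 in eb1 ec1; set v := class_col 2 c b' 2 in eb2 ec2 lk.
have hw : (2 <= st_width n 2 b' < 2 * 2)%N by apply: st_width_bounds.
have iu : col_index 2 u = 1%N.
  have h1 : (1 <= 1 <= st_width n 2 b')%N by lia.
  have [_ _ ] := mkcol_spec c an b'L h1; rewrite /u /class_col ifT //; lia.
have uc : u != c by apply: contraNneq b'b => e; rewrite -eb1 e.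
have vc : v != c by apply: contraNneq b'b => e; rewrite -eb2 e.
have uv : u != v by apply/eqP => e; move: ec1; rewrite e ec2.
have S3 : #|[set c; u; v]| = 3%N.
  rewrite -setUA cardsU1 cards2 uv !inE negb_or ![c == _]eq_sym uc vc //.
exists [set c; u; v]; split=> //.
- by rewrite !inE eqxx.
- apply/negP => /fintype.subsetP /(_ v); rewrite !inE eqxx orbT => /(_ isT).
  rewrite (negPf vc) /= ec2 cc /= /col_linked eb2.
  by rewrite (negPf b'b).
- move=> o; rewrite !inE => /orP[/orP[]|] /eqP-> //; rewrite ?eb1 ?eb2 => e;
  by rewrite e eqxx in b'b.
- apply: protected_row => //; first by lia.
  move=> o; rewrite !inE => /orP[/orP[]|] /eqP->.
  + by exists c; rewrite ?inE ?eqxx //; split=> //; apply: col_linked_refl.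
  + by exists u; rewrite ?inE ?eqxx ?orbT //; split; rewrite ?ec1 ?cc //; apply: col_linked_refl.
  + exists u; rewrite ?inE ?eqxx ?orbT //; split; rewrite ?ec1 ?cc //.
    by apply: lk => //; rewrite iu; lia.
Qed.

(** * Counting the unprotected sets *)

Lemma card_supersets (T : finType) (G : {set T}) k : (#|G| <= k)%N ->
  #|[set S : {set T} | (G \subset S) && (#|S| == k)]| = 'C(#|T| - #|G|, k - #|G|).
Proof.
move=> Gk; rewrite -cardsT -(setUCr G) cardsU setICr cards0 subn0 addKn.
have dG : [disjoint G & ~: G] by rewrite -setI_eq0 setICr.
rewrite -(card_between dG Gk); apply: eq_card => S.
by rewrite !inE setUCr subsetT.
Qed.

Lemma unprotected_trivial (F : fieldType) n k alpha (x : nat -> F) i (c : 'I_n) :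
  (1 <= alpha <= n)%N -> (i <= col_class alpha c)%N ->
  #|unprotected k alpha x i c| = 0%N.
Proof.
move=> an hi; apply/eqP; rewrite cards_eq0; apply/eqP/setP => S; rewrite !inE.
apply/negP => /and3P[_ _ /asboolPn[]] tau d _ _.
by rewrite codeword_slopeE // st_slope_trivial.
Qed.

(** Protection through the row is enough: for [k = 1] it covers the only set, for [k = 2] at least
    two of the [n - 1] pairs. *)
Lemma unprotected_small_k (F : fieldType) n k alpha (x : nat -> F) i (c : 'I_n) :
  injective_points n x -> (1 <= k <= 2)%N -> (k + alpha <= n)%N -> (2 <= alpha)%N ->
  (col_class alpha c < i <= alpha)%N ->
  (#|unprotected k alpha x i c| <= if k == 1 then 0 else n - 3)%N.
Proof.
move=> xI k12 nk a2 hi; have an : (1 <= alpha <= n)%N by lia.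
have k1 : (1 <= k)%N by lia. have kn : (k <= n)%N by lia.
have N2 : (k != 1)%N -> (2 <= #|row_cols alpha c|)%N.
  move=> ek; case: (leqP (col_index alpha c) (2 * alpha - col_width alpha c)) => hc; last first.
    exact: card_row_cols_high hi.
  apply: leq_trans (card_row_cols_low an hc).
  have : (0 < n %/ alpha)%N by rewrite divn_gt0; lia.
  case: (eqVneq alpha 2%N) => [e|ne]; last by lia.
  by move=> _; rewrite e; lia.
pose X := [set S : {set 'I_n} |
  [&& [set c] \subset S, S \subset [set c] :|: row_cols alpha c & #|S| == k]].
have cX : #|X| = 'C(#|row_cols alpha c|, k - 1).
  rewrite card_between ?cards1 // -setI_eq0; apply/eqP/setP => o; rewrite !inE.
  by case: eqVneq.
have := @unprotected_le F n k alpha x i c X k1; rewrite cX => H.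
have {}H : (#|unprotected k alpha x i c| + 'C(#|row_cols alpha c|, k - 1) <= 'C(n.-1, k.-1))%N.
  apply: H => S; rewrite inE sub1set => /and3P[cS SN /eqP Sk]; split=> //.
  by apply: protected_row_cols => //; lia.
case: eqVneq => ek; first by move: H; rewrite ek !bin0; lia.
have {}N2 := N2 ek; have e2 : k = 2%N by lia.
by move: H; rewrite e2 !bin1; lia.
Qed.

Lemma bin_ge2 a b : (1 <= b)%N -> (b < a)%N -> (2 <= 'C(a, b))%N.
Proof. by move=> h1 h2; apply: leq_trans (leq_bin_diag (_ : 1 <= 2)%N h1 _ _) => //; lia. Qed.

Lemma ceil_div_eq1 k alpha : (1 <= k <= alpha)%N -> ceil_div k alpha = 1%N.
Proof.
move=> hk; have [] := @ceil_div_bounds k alpha; first by lia.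
set K := ceil_div k alpha => h1 h2; case: K h1 h2 => [|[|K]] //; first by lia.
by rewrite !mulSn; lia.
Qed.

(** There are ['C(n - 2, k - 2)] sets containing the guard. For [k = 3] and [alpha = 2] they fall
    one short when [n = 5], which [extra_protected] makes up for. *)
Lemma unprotected_two_guard (F : fieldType) n k alpha (x : nat -> F) i (c : 'I_n) :
  injective_points n x -> (3 <= k)%N -> (k + alpha <= n)%N -> (2 <= alpha)%N ->
  (col_class alpha c < i <= alpha)%N ->
  ((col_index alpha c <= 2 * alpha - col_width alpha c)%N ->
     (i <= 2 * alpha - col_width alpha c)%N) ->
  (#|unprotected k alpha x i c| +
     'C((ceil_div n alpha).-1, (ceil_div k alpha).-1) + 2 <= 'C(n.-1, k.-1))%N.
Proof.
move=> xI k3 nk a2 hi low; have an : (1 <= alpha <= n)%N by lia.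
have k1 : (1 <= k)%N by lia.
have [g [gc eg prot]] := two_column_guard k x an hi low.
pose X := [set S : {set 'I_n} | ([set c; g] \subset S) && (#|S| == k)].
have cG : #|[set c; g]| = 2%N by rewrite cards2 eq_sym gc.
have cX : #|X| = 'C(n - 2, k - 2) by rewrite card_supersets ?cG ?card_ord //; lia.
have XP S : S \in X -> [/\ #|S| = k, c \in S & protected k alpha x i c.+1 S].
  rewrite inE => /andP[/fintype.subsetP GS /eqP Sk].
  have cS : c \in S by apply: GS; rewrite !inE eqxx.
  by split=> //; apply: prot => //; apply: GS; rewrite !inE eqxx orbT.
have [/andP[K1 KN] gap K2] := ceil_div_gap k1 a2 nk.
have a1 : (1 <= alpha)%N by lia.
have [nl nu] := ceil_div_bounds n a1.
case: (ltnP 3 k) => [k4|k3'].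
  have := unprotected_le k1 XP; rewrite cX.
  (* Pascal's rule: one summand dominates the subtracted binomial coefficient, the other supplies
     the 2. *)
  have -> : (n - 2 = (n - 3).+1)%N by lia.
  have -> : (k - 2 = (k - 3).+1)%N by lia.
  rewrite binS.
  have : (2 <= 'C(n - 3, k - 3))%N by apply: bin_ge2; lia.
  have : ('C((ceil_div n alpha).-1, (ceil_div k alpha).-1) <= 'C(n - 3, (k - 3).+1))%N.
    by apply: leq_bin_diag; lia.
  lia.
have ek : k = 3%N by lia.
subst k; case: (ltnP 2 alpha) => a3.
  have := unprotected_le k1 XP; rewrite cX (@ceil_div_eq1 3) /= ?bin0; last by lia.
  by rewrite bin1; lia.
have ea : alpha = 2%N by lia.
subst alpha.
have [S0 [S0k cS0 _ S0b S0p]] : exists S : {set 'I_n}, [/\ #|S| = 3%N, c \in S,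
    ~~ (S \subset [set c] :|: row_cols 2 c),
    forall o, o \in S -> col_block 2 o = col_block 2 c -> o = c &
    protected 3 2 x i c.+1 S].
  apply: extra_protected => //; try lia.
  have [_ hj _] := col_spec c an; have hw := col_width_bounds c an.
  by have := st_class_bounds hw hj; move: hi; rewrite /col_class; lia.
have S0X : S0 \notin X.
  rewrite inE; apply/negP => /andP[/fintype.subsetP /(_ g)].
  by rewrite !inE eqxx orbT => /(_ isT) /S0b /(_ eg) e; rewrite e eqxx in gc.
have := @unprotected_le F n 3 2 x i c (S0 |: X) k1.
rewrite cardsU1 S0X cX bin1 (_ : ceil_div 3 2 = 2%N) // bin1 => H.
have {}H : (#|unprotected 3 2 x i c| + (true + (n - 2)) <= 'C(n.-1, 2))%N.
  by apply: H => S; rewrite in_setU1 => /orP[/eqP->|/XP].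
move: H; rewrite /=; lia.
Qed.

(** Only ['C(n - 3, k - 3)] sets contain both guards. For [k <= 4] the sets [Y] protected through
    the row are added, and for [k = 3], [alpha = 2] also an extra one. With [n = 5], which forces
    these parameters, the count stays one short: hence the term [(n == 5)]. *)
Lemma unprotected_three_guard (F : fieldType) n k alpha (x : nat -> F) i (c : 'I_n) :
  injective_points n x -> (3 <= k)%N -> (k + alpha <= n)%N -> (2 <= alpha)%N ->
  (1 <= i <= alpha)%N ->
  (col_index alpha c <= 2 * alpha - col_width alpha c < i)%N ->
  (#|unprotected k alpha x i c| +
     'C((ceil_div n alpha).-1, (ceil_div k alpha).-1) + 2
       <= 'C(n.-1, k.-1) + (n == 5))%N.
Proof.
move=> xI k3 nk a2 hi low; have an : (1 <= alpha <= n)%N by lia.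
have k1 : (1 <= k)%N by lia. have kn : (k <= n)%N by lia.
have [g [g' [ug eg gN prot]]] := three_column_guard k x an hi low.
pose X := [set S : {set 'I_n} | ([set c; g; g'] \subset S) && (#|S| == k)].
have cG : #|[set c; g; g']| = 3%N.
  move: ug; rewrite /= !inE negb_or andbT => /andP[/andP[h1 h2] h3].
  by rewrite -setUA cardsU1 cards2 h3 !inE negb_or h1 h2.
have cX : #|X| = 'C(n - 3, k - 3) by rewrite card_supersets ?cG ?card_ord //; lia.
have gc : g != c by move: ug; rewrite /= !inE negb_or eq_sym => /andP[/andP[]].
have XP S : S \in X -> [/\ #|S| = k, c \in S & protected k alpha x i c.+1 S].
  rewrite inE => /andP[/fintype.subsetP GS /eqP Sk].
  have cS : c \in S by apply: GS; rewrite !inE eqxx.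
  by split=> //; apply: prot => //; apply: GS; rewrite !inE eqxx ?orbT.
have [/andP[K1 KN] gap K2] := ceil_div_gap k1 a2 nk.
have a1 : (1 <= alpha)%N by lia.
have [nl nu] := ceil_div_bounds n a1.
case: (ltnP 4 k) => [k5|k4].
  have := unprotected_le k1 XP; rewrite cX.
  have -> : (n - 3 = (n - 4).+1)%N by lia.
  have -> : (k - 3 = (k - 4).+1)%N by lia.
  rewrite binS.
  have : (2 <= 'C(n - 4, k - 4))%N by apply: bin_ge2; lia.
  have : ('C((ceil_div n alpha).-1, (ceil_div k alpha).-1) <= 'C(n - 4, (k - 4).+1))%N.
    by apply: leq_bin_diag; lia.
  lia.
pose Y := [set S : {set 'I_n} |
  [&& [set c] \subset S, S \subset [set c] :|: row_cols alpha c & #|S| == k]].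
have cY : #|Y| = 'C(#|row_cols alpha c|, k - 1).
  rewrite card_between ?cards1 // -setI_eq0; apply/eqP/setP => o; rewrite !inE.
  by case: eqVneq.
have cY' : ('C(alpha + n %/ alpha - 2, k - 1) <= #|Y|)%N.
  by rewrite cY; apply: leq_bin2l; apply: card_row_cols_low => //; case/andP: low.
have YP S : S \in Y -> [/\ #|S| = k, c \in S & protected k alpha x i c.+1 S].
  rewrite inE sub1set => /and3P[cS SN /eqP Sk]; split=> //.
  exact: protected_row_cols.
have XY : X :&: Y = set0.
  apply/setP => S; rewrite !inE; apply/negP.
  case/andP => /andP[/fintype.subsetP GS _] /and3P[_ /fintype.subsetP SN _].
  have /SN : g \in S by apply: GS; rewrite !inE eqxx orbT.
  by rewrite in_setU (negPf gN) orbF inE (negPf gc).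
have cXY : #|X :|: Y| = ('C(n - 3, k - 3) + #|Y|)%N by rewrite cardsU XY cards0 subn0 cX.
have XYP S : S \in X :|: Y -> [/\ #|S| = k, c \in S & protected k alpha x i c.+1 S].
  by rewrite inE => /orP[/XP|/YP].
have en := divn_eq n alpha; have er := ltn_pmod n a1.
(* Without a remainder every block has width [alpha], so [m = alpha] and no row lies beyond [m]. *)
have nodd : (n %% alpha != 0)%N.
  apply/eqP => e; move: low; rewrite /col_width /st_width e addn0 if_same; lia.
case: (ltnP 3 k) => [k4'|k3'].
  have ek : k = 4%N by lia.
  subst k; have := unprotected_le k1 XYP; rewrite cXY bin1.
  case: (ltnP 3 alpha) => [a4|a3].
    by rewrite (@ceil_div_eq1 4) /= ?bin0; lia.
  have e2 : ceil_div 4 alpha = 2%N.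
    by have [->|->] : alpha = 2%N \/ alpha = 3%N by lia.
  rewrite e2 bin1.
  have [e|e] : alpha = 2%N \/ alpha = 3%N by lia.
    have Y1 : (1 <= #|Y|)%N by apply: leq_trans cY'; rewrite e bin_gt0; move: nodd; rewrite e; lia.
    move: nl nu nodd; rewrite e; lia.
  move: nl nu; rewrite e; lia.
have ek : k = 3%N by lia.
subst k; case: (ltnP 2 alpha) => a3.
  have Y3 : (3 <= #|Y|)%N.
    apply: leq_trans cY'; apply: (@leq_bin2l 3 _ 2); case: (ltnP 3 alpha) => a4.
      have : (0 < n %/ alpha)%N by rewrite divn_gt0; lia.
      lia.
    have -> : alpha = 3%N by lia.
    have := leq_div2r 3 (_ : 6 <= n)%N; lia.
  have := unprotected_le k1 XYP; rewrite cXY (@ceil_div_eq1 3) /= ?bin0; last by lia.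
  move: Y3; set y := #|Y|; set u := #|unprotected _ _ _ _ _|; set t := 'C(n.-1, 2).
  by clearbody y u t; lia.
have ea : alpha = 2%N by lia.
subst alpha.
have [S0 [S0k cS0 S0N S0b S0p]] : exists S : {set 'I_n}, [/\ #|S| = 3%N, c \in S,
    ~~ (S \subset [set c] :|: row_cols 2 c),
    forall o, o \in S -> col_block 2 o = col_block 2 c -> o = c &
    protected 3 2 x i c.+1 S].
  apply: extra_protected => //; try lia.
  have [_ hj _] := col_spec c an; have hw := col_width_bounds c an.
  rewrite /col_class /st_class; case/andP: low => h1 h2; rewrite h1; lia.
have S0XY : S0 \notin X :|: Y.
  rewrite !inE negb_or; apply/andP; split.
    apply/negP => /andP[/fintype.subsetP /(_ g)].
    by rewrite !inE eqxx orbT => /(_ isT) /S0b /(_ eg) e; rewrite e eqxx in gc.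
  by rewrite (negPf S0N) andbF.
have := @unprotected_le F n 3 2 x i c (S0 |: (X :|: Y)) k1.
rewrite cardsU1 S0XY cXY (_ : ceil_div 3 2 = 2%N) // bin1 bin0 => H.
have {}H : (#|unprotected 3 2 x i c| + (true + (1 + #|Y|)) <= 'C(n.-1, 2))%N.
  by apply: H => S; rewrite in_setU1 => /orP[/eqP->|/XYP].
move: H cY'; rewrite /= addKn (_ : (3 - 1 = 2)%N) //.
have z1 : (1 <= 'C(n %/ 2, 2))%N by rewrite bin_gt0; lia.
(* Apart from [n = 5] there are [L >= 3] blocks, and then [L <= L * (L - 1) / 2]. *)
have zL : (n != 5)%N -> (n %/ 2 <= 'C(n %/ 2, 2))%N.
  move=> n5; have L3 : (3 <= n %/ 2)%N by lia.
  move: (n %/ 2)%N L3 => L L3; have := mul_bin_diag L 1.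
  by rewrite bin1; nia.
move: z1 zL; set z := 'C(n %/ 2, 2); set y := #|Y|; set u := #|unprotected _ _ _ _ _|.
set t := 'C(n.-1, 2); clearbody z y u t => z1 zL.
case: (eqVneq n 5%N) zL => [e _|n5 /(_ isT) zL]; lia.
Qed.

(** * The parameters (5, 3, 2) over the field with five elements *)

(* The nonvanishing of these three polynomials is what the node sets
   {1,3,4}, {2,3,4} and {2,3,5} require of the coefficient [t] of the last
   block when (n,k,alpha) = (5,3,2); they are written over arbitrary operations
   in order to be evaluated both in a field and in the residues modulo 5. *)
Definition cond134 {T : Type} (add sub mul : T -> T -> T) (y1 y2 y3 y4 y5 t : T) : T :=
  let A := mul (sub y4 y1) (sub y4 y3) in
  let B := mul (sub y5 y1) (sub y5 y3) in
  sub (mul t (add A B)) A.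

Definition cond234 {T : Type} (add sub mul : T -> T -> T) (y1 y2 y3 y4 y5 t : T) : T :=
  let A := mul (sub y1 y2) (sub y1 y4) in
  let C := mul (sub y3 y2) (sub y3 y4) in
  let CD := mul C (mul (mul (sub y2 y3) (sub y2 y4)) (sub y4 y3)) in
  let E := mul A (mul (mul (sub y5 y3) (sub y5 y4)) (sub y4 y3)) in
  let G := mul C (mul (mul (sub y5 y3) (sub y5 y2)) (sub y2 y3)) in
  add CD (mul t (sub (sub G CD) E)).

Definition cond235 {T : Type} (add sub mul : T -> T -> T) (y1 y2 y3 y4 y5 t : T) : T :=
  sub (mul (mul (sub y2 y3) (sub y2 y5)) (mul (sub y3 y2) (sub y3 y5)))
      (mul t (mul (mul (sub y4 y3) (sub y4 y5)) (mul (sub y1 y2) (sub y1 y5)))).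

Definition add5 a b := ((a + b) %% 5)%N.
(** Here [4 * b] stands for [- b] modulo 5. *)
Definition sub5 a b := ((a + 4 * b) %% 5)%N.
Definition mul5 a b := ((a * b) %% 5)%N.

Definition conds5 (y1 y2 y3 y4 y5 t : nat) : bool :=
  [&& cond134 add5 sub5 mul5 y1 y2 y3 y4 y5 t != 0%N,
      cond234 add5 sub5 mul5 y1 y2 y3 y4 y5 t != 0%N &
      cond235 add5 sub5 mul5 y1 y2 y3 y4 y5 t != 0%N].

Lemma conds5_solvable : let r := iota 0 5 in
  all (fun y1 => all (fun y2 => all (fun y3 => all (fun y4 => all (fun y5 =>
    uniq [:: y1; y2; y3; y4; y5] ==>
      has (conds5 y1 y2 y3 y4 y5) [:: 2; 3; 4]%N) r) r) r) r) r.
Proof. by vm_compute. Qed.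

(** A field with five elements has characteristic 5 and is the image of the residues, so the search
    over residues carries over. *)
Lemma cond_exists (F : finFieldType) (y1 y2 y3 y4 y5 : F) :
  #|F| = 5%N -> uniq [:: y1; y2; y3; y4; y5] ->
  exists t : F, [/\ t != 0, t != 1,
    cond134 +%R (fun a b => a - b) *%R y1 y2 y3 y4 y5 t != 0,
    cond234 +%R (fun a b => a - b) *%R y1 y2 y3 y4 y5 t != 0 &
    cond235 +%R (fun a b => a - b) *%R y1 y2 y3 y4 y5 t != 0].
Proof.
move=> F5 uy; have ch : 5%N \in [pchar F] by apply: (@card_finPcharP _ 5 1).
have nu0 a : (a%:R == 0 :> F) = (a %% 5 == 0)%N by rewrite -(dvdn_pcharf ch).
have five : 5%:R = 0 :> F by apply/eqP; rewrite nu0.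
have nuM5 a : (a %% 5)%:R = a%:R :> F.
  by rewrite [in RHS](divn_eq a 5) natrD natrM five mulr0 add0r.
have nuA a b : (add5 a b)%:R = a%:R + b%:R :> F by rewrite nuM5 natrD.
have nuM a b : (mul5 a b)%:R = a%:R * b%:R :> F by rewrite nuM5 natrM.
have nuS a b : (sub5 a b)%:R = a%:R - b%:R :> F.
  rewrite nuM5 natrD natrM; have -> : 4%:R = -1 :> F by apply/eqP; rewrite -addr_eq0 natr1 five.
  by rewrite mulN1r.
have nu_inj : injective (fun a : 'I_5 => a%:R : F).
  move=> a b /= e; apply/val_inj => /=.
  have : (sub5 a b)%:R = 0 :> F by rewrite nuS e subrr.
  move/eqP; rewrite nu0 /sub5; have := ltn_ord a; have := ltn_ord b; lia.
have rep y : exists2 a : 'I_5, true & y = a%:R :> F.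
  have [g _ gK] : bijective (fun a : 'I_5 => a%:R : F).
    by apply: inj_card_bij; rewrite // F5 card_ord.
  by exists (g y).
have [a1 _ e1] := rep y1; have [a2 _ e2] := rep y2; have [a3 _ e3] := rep y3.
have [a4 _ e4] := rep y4; have [a5 _ e5] := rep y5.
have ua : uniq [:: val a1; val a2; val a3; val a4; val a5].
  rewrite (_ : [:: _; _; _; _; _] = map val [:: a1; a2; a3; a4; a5]) //.
  rewrite (map_inj_uniq val_inj) -(map_inj_uniq nu_inj) /=.
  by rewrite -e1 -e2 -e3 -e4 -e5.
have mi (a : 'I_5) : val a \in iota 0 5 by rewrite mem_iota ltn_ord.
have := conds5_solvable; cbv zeta.
move=> /allP/(_ _ (mi a1))/allP/(_ _ (mi a2))/allP/(_ _ (mi a3)).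
move=> /allP/(_ _ (mi a4))/allP/(_ _ (mi a5)); rewrite ua implyTb.
case/hasP=> t tin /and3P[c1 c2 c3]; exists t%:R.
have t01 : t%:R != 0 :> F /\ t%:R != 1 :> F.
  split; first by rewrite nu0; move: tin; rewrite !inE => /or3P[] /eqP->.
  rewrite -subr_eq0; have -> : t%:R - 1 = (sub5 t 1)%:R :> F by rewrite nuS.
  rewrite nu0.
  by move: tin; rewrite !inE => /or3P[] /eqP->.
have lt5 : forall y1 y2 y3 y4 y5 t, [&& cond134 add5 sub5 mul5 y1 y2 y3 y4 y5 t < 5,
   cond234 add5 sub5 mul5 y1 y2 y3 y4 y5 t < 5 & cond235 add5 sub5 mul5 y1 y2 y3 y4 y5 t < 5]%N.
  by move=> *; rewrite /cond134 /cond234 /cond235 /sub5 /add5 !ltn_pmod.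
have nz a : (a < 5)%N -> a != 0%N -> a%:R != 0 :> F.
  by move=> h; rewrite nu0 modn_small.
case/and3P: (lt5 a1 a2 a3 a4 a5 t) => l1 l2 l3.
move: (nz _ l1 c1) (nz _ l2 c2) (nz _ l3 c3).
rewrite /cond134 /cond234 /cond235 !(nuS, nuA, nuM) -e1 -e2 -e3 -e4 -e5 => n1 n2 n3.
by case: t01 => t0 t1; split.
Qed.

Lemma quadratic_roots (F : fieldType) (a b c y z w : F) : y != z ->
  a + b * y + c * y ^+ 2 = 0 -> a + b * z + c * z ^+ 2 = 0 ->
  a + b * w + c * w ^+ 2 = c * ((w - y) * (w - z)).
Proof.
move=> yz e1 e2.
have : (y - z) * (b + c * (y + z)) = 0.
  by transitivity ((a + b * y + c * y ^+ 2) - (a + b * z + c * z ^+ 2)); [ring | rewrite e1 e2 subrr].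
move/eqP; rewrite mulf_eq0 subr_eq0 (negPf yz) /= => /eqP eb.
transitivity (c * ((w - y) * (w - z)) + (w - y) * (b + c * (y + z)) + (a + b * y + c * y ^+ 2)).
  ring.
by rewrite eb e1 mulr0 !addr0.
Qed.

Lemma quadratic_eq0 (F : fieldType) (a b c y z w v : F) :
  y != z -> w != y -> w != z ->
  a + b * y + c * y ^+ 2 = 0 -> a + b * z + c * z ^+ 2 = 0 ->
  a + b * w + c * w ^+ 2 = 0 -> a + b * v + c * v ^+ 2 = 0.
Proof.
move=> yz wy wz ey ez ew; rewrite (quadratic_roots v yz ey ez).
move/eqP: ew; rewrite (quadratic_roots w yz ey ez) !mulf_eq0 !subr_eq0.
by rewrite (negPf wy) (negPf wz) !orbF => /eqP->; rewrite mul0r.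
Qed.

(** The coefficient [t] sits in row 2 of node 3, the only (B2) position, and the others are still 0.
    Of the six sets containing node 3, {1,2,3} and {1,3,5} decode row 1, {3,4,5} contains both
    guards, and the other three are handled by the conditions on [t]. *)
Lemma recoverable_5_3_2 (F : finFieldType) (x : nat -> F) :
  #|F| = 5%N -> injective_points 5 x ->
  exists t : F, [/\ t != 0, t != 1 & forall S : {set 'I_5}, #|S| = 3%N ->
    recoverable 3 2 x (update (fun _ _ => 0) 2 3 t) S].
Proof.
move=> F5 xI.
have xne u v : (1 <= u <= 5)%N -> (1 <= v <= 5)%N -> u != v -> x u != x v.
  by move=> hu hv; apply: contraNneq => e; apply/eqP; apply: xI.
have [|t [t0 t1 n134 n234 n235]] := @cond_exists F (x 1) (x 2) (x 3) (x 4) (x 5) F5.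
  by rewrite /= !inE !negb_or !xne.
exists t; split=> // S S3 d Kd.
apply: (recoverable0 xI _ _ S3) => //; apply: st_kernel_eq (Kd) => // i c hi cS.
rewrite /update; case: andP => [[/eqP ei /eqP ec]|_]; last by rewrite subrr mul0r.
rewrite subr0 ei ec.
(* If the slope vanishes, then [d] lies in the kernel for zero coefficients. *)
suff -> : codeword_slope 5 3 2 x d 2 3 = 0 by rewrite mulr0.
have -> : codeword_slope 5 3 2 x d 2 3 = base_array 3 x d 1 4 + base_array 3 x d 1 5 by [].
have c3 : (inord 2 : 'I_5) \in S.
  by rewrite (_ : inord 2 = c) //; apply/val_inj; rewrite /= inordK //; case: ec.
have quad i' : exists abc : F * F * F, forall j, (1 <= j <= 5)%N ->
    base_array 3 x d i' j = abc.1.1 + abc.1.2 * x j + abc.2 * x j ^+ 2.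
  have [|p sp pE] := @base_array_poly F 5 3 x d i' xI; first by [].
  exists (p`_0, p`_1, p`_2) => j hj; rewrite pE // (horner_coef_wide _ sp).
  by rewrite !big_ord_recl big_ord0 /= expr0 expr1 /bump /=; ring.
have [[[a1 b1] c1] /= q1] := quad 1%N; have [[[a2 b2] c2] /= q2] := quad 2%N.
have K1 : (inord 0 : 'I_5) \in S -> base_array 3 x d 1 1 = 0 /\ base_array 3 x d 2 1 = 0.
  move=> h; have := Kd 1%N _ isT h; have := Kd 2%N _ isT h; rewrite inordK //= => h2 h1.
  by split; [exact: h1 | rewrite -[LHS]addr0 -[X in _ + X = _](mul0r (base_array 3 x d 1 2)); exact: h2].
have K2 : (inord 1 : 'I_5) \in S -> base_array 3 x d 1 2 + base_array 3 x d 2 1 = 0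
    /\ base_array 3 x d 2 2 = 0.
  by move=> h; have := Kd 1%N _ isT h; have := Kd 2%N _ isT h; rewrite inordK.
have K3 : base_array 3 x d 1 3 = 0 /\ base_array 3 x d 2 3 +
    t * (base_array 3 x d 1 4 + base_array 3 x d 1 5) = 0.
  by have := Kd 1%N _ isT c3; have := Kd 2%N _ isT c3; rewrite inordK.
have K4 : (inord 3 : 'I_5) \in S -> base_array 3 x d 1 4 + base_array 3 x d 2 3 = 0
    /\ base_array 3 x d 2 4 = 0.
  by move=> h; have := Kd 1%N _ isT h; have := Kd 2%N _ isT h; rewrite inordK.
have K5 : (inord 4 : 'I_5) \in S -> base_array 3 x d 1 5 = 0 /\ base_array 3 x d 2 5 = 0.
  by move=> h; have := Kd 1%N _ isT h; have := Kd 2%N _ isT h; rewrite inordK.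
move: K1 K2 K3 K4 K5; rewrite !q1 // !q2 //.
set y1 := x 1 in n134 n234 n235 *; set y2 := x 2 in n134 n234 n235 *.
set y3 := x 3 in n134 n234 n235 *; set y4 := x 4 in n134 n234 n235 *.
set y5 := x 5 in n134 n234 n235 *.
(* Exactly two nodes other than node 3 belong to [S], which leaves six cases. *)
have sumS : ((inord 0 \in S) + (inord 1 \in S) + (inord 3 \in S) + (inord 4 \in S) = 2)%N.
  have : #|S| = (\sum_(0 <= m < 5) (inord m \in S))%N.
    rewrite -sum1_card big_mkcond big_mkord; apply: eq_bigr => m _.
    by rewrite inord_val; case: (m \in S).
  by rewrite S3 !big_nat_recr //= big_nil c3; lia.
move=> K1 K2 [f13 f23] K4 K5.
case: (inord 0 \in S) K1 sumS => [/(_ isT)[f11 f21]|_];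
  case: (inord 1 \in S) K2 => [/(_ isT)[f12 f22]|_];
  case: (inord 3 \in S) K4 => [/(_ isT)[f14 f24]|_];
  case: (inord 4 \in S) K5 => [/(_ isT)[f15 f25]|_] //= _.
- rewrite f21 addr0 in f12.
  have Z v : a1 + b1 * v + c1 * v ^+ 2 = 0.
    by apply: (@quadratic_eq0 _ _ _ _ y1 y3 y2) => //; apply: xne.
  by rewrite (Z y4) (Z y5) addr0.
(* Nodes 1, 3, 4: row 1 has the roots [y1] and [y3], and subtracting [f14] from [f23] gives [c1]
   times the condition. *)
- have y13 : y1 != y3 by apply: xne.
  have E4 := quadratic_roots y4 y13 f11 f13; have E5 := quadratic_roots y5 y13 f11 f13.
  move: f14 f23; rewrite E4 E5 => f14 f23.
  have : c1 * cond134 +%R (fun a b => a - b) *%R y1 y2 y3 y4 y5 t = 0.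
    rewrite /cond134; apply: (etrans _ (etrans (congr2 (fun u v => v - u) f14 f23) (subrr 0))).
    ring.
  by move/eqP; rewrite mulf_eq0 (negPf n134) orbF => /eqP->; rewrite !mul0r addr0.
- have Z v : a1 + b1 * v + c1 * v ^+ 2 = 0.
    by apply: (@quadratic_eq0 _ _ _ _ y1 y3 y5) => //; apply: xne.
  by rewrite (Z y4) (Z y5) addr0.
- have y24 : y2 != y4 by apply: xne.
  have E1 := quadratic_roots y1 y24 f22 f24; have E3 := quadratic_roots y3 y24 f22 f24.
  (* Nodes 2, 3, 4: Lagrange interpolation of row 1 at [y5] from [y2], [y3], [y4], with denominators
     cleared. *)
  have E5 : (a1 + b1 * y5 + c1 * y5 ^+ 2) * ((y2 - y3) * (y2 - y4) * (y4 - y3)) =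
     (a1 + b1 * y2 + c1 * y2 ^+ 2) * ((y5 - y3) * (y5 - y4) * (y4 - y3))
     - (a1 + b1 * y4 + c1 * y4 ^+ 2) * ((y5 - y3) * (y5 - y2) * (y2 - y3))
     + (a1 + b1 * y3 + c1 * y3 ^+ 2) * ((y5 - y2) * (y5 - y4) * (y2 - y4)) by ring.
  rewrite f13 mul0r addr0 in E5.
  move: f12 f14 f23; rewrite E1 E3 => /eqP; rewrite addr_eq0 => /eqP f12 /eqP.
  rewrite addr_eq0 => /eqP f14 f23; rewrite f12 f14 in E5; rewrite f14 in f23.
  have : c2 * cond234 +%R (fun a b => a - b) *%R y1 y2 y3 y4 y5 t = 0.
    have -> : c2 * cond234 +%R (fun a b => a - b) *%R y1 y2 y3 y4 y5 t =
      (c2 * ((y3 - y2) * (y3 - y4)) + t * (- (c2 * ((y3 - y2) * (y3 - y4)))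
         + (a1 + b1 * y5 + c1 * y5 ^+ 2))) * ((y2 - y3) * (y2 - y4) * (y4 - y3))
      - t * ((a1 + b1 * y5 + c1 * y5 ^+ 2) * ((y2 - y3) * (y2 - y4) * (y4 - y3))
         - (- (c2 * ((y1 - y2) * (y1 - y4))) * ((y5 - y3) * (y5 - y4) * (y4 - y3))
            - - (c2 * ((y3 - y2) * (y3 - y4))) * ((y5 - y3) * (y5 - y2) * (y2 - y3)))).
      by rewrite /cond234; ring.
    by rewrite f23 E5 subrr mul0r mulr0 subrr.
  move/eqP; rewrite mulf_eq0 (negPf n234) orbF => /eqP c20.
  rewrite c20 mul0r oppr0 in f12; rewrite c20 mul0r oppr0 in f14.
  have Z v : a1 + b1 * v + c1 * v ^+ 2 = 0.
    by apply: (@quadratic_eq0 _ _ _ _ y2 y3 y4) => //; apply: xne.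
  by rewrite (Z y4) (Z y5) addr0.
(* Nodes 2, 3, 5: row 1 has the roots [y3], [y5] and row 2 the roots [y2], [y5]. Two linear
   equations in [c1] and [c2] remain, and [cond235] is their determinant. *)
- have y35 : y3 != y5 by apply: xne. have y25 : y2 != y5 by apply: xne.
  have E4 := quadratic_roots y4 y35 f13 f15; have E2 := quadratic_roots y2 y35 f13 f15.
  have G1 := quadratic_roots y1 y25 f22 f25; have G3 := quadratic_roots y3 y25 f22 f25.
  rewrite f15 addr0 E4; rewrite E2 G1 in f12; rewrite f15 addr0 E4 G3 in f23.
  have : c1 * cond235 +%R (fun a b => a - b) *%R y1 y2 y3 y4 y5 t = 0.
    have -> : c1 * cond235 +%R (fun a b => a - b) *%R y1 y2 y3 y4 y5 t =
      (c1 * ((y2 - y3) * (y2 - y5)) + c2 * ((y1 - y2) * (y1 - y5)))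
        * ((y3 - y2) * (y3 - y5))
      - (c2 * ((y3 - y2) * (y3 - y5)) + t * (c1 * ((y4 - y3) * (y4 - y5))))
        * ((y1 - y2) * (y1 - y5)) by rewrite /cond235; ring.
    by rewrite f12 f23 !mul0r subrr.
  by move/eqP; rewrite mulf_eq0 (negPf n235) orbF => /eqP->; rewrite mul0r.
- rewrite f15 addr0 in f23 *.
  by have [] := pair_solve t1 f14 f23.
Qed.

(** * The theorem *)

Lemma card_ge_points (F : finFieldType) n (x : nat -> F) :
  injective_points n x -> (n <= #|F|)%N.
Proof.
move=> xI; rewrite -[n]card_ord.
apply: (@leq_card _ _ (fun c : 'I_n => x c.+1)) => u v /xI e.
by apply/val_inj/succn_inj/e; rewrite /= ltn_ord.
Qed.

Lemma unprotected_card (F : finFieldType) n k alpha (x : nat -> F) i (c : 'I_n) :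
  (1 <= k)%N -> (k + alpha <= n)%N -> (2 <= alpha)%N -> (2 < #|F|)%N ->
  ('C(n.-1, k.-1) - 'C((ceil_div n alpha).-1, (ceil_div k alpha).-1) < #|F|)%N ->
  injective_points n x -> (1 <= i <= alpha)%N ->
  (n = 5%N -> #|F| = 5%N -> (3 <= k)%N ->
    (col_index alpha c <= 2 * alpha - col_width alpha c < i)%N -> False) ->
  (#|unprotected k alpha x i c| + 2 < #|F|)%N.
Proof.
move=> k1 nk a2 F2 bound xI hi ex; have an : (1 <= alpha <= n)%N by lia.
case: (leqP i (col_class alpha c)) => [triv|hc].
  by rewrite unprotected_trivial.
have {}hc : (col_class alpha c < i <= alpha)%N by lia.
have Fn := card_ge_points xI.
case: (leqP k 2) => k3.
  (* For [k = 2] the count [n - 3] is concluded by [n <= #|F|], for [k = 1] by [2 < #|F|]. *)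
  have := unprotected_small_k xI (_ : 1 <= k <= 2)%N nk a2 hc.
  by case: eqVneq => ek; lia.
move: bound; set X := 'C((ceil_div n alpha).-1, _) => bound.
have [low|nlow] := boolP (col_index alpha c <= 2 * alpha - col_width alpha c < i)%N; last first.
  have := @unprotected_two_guard _ _ k alpha x i c xI k3 nk a2 hc.
  by lia.
have := @unprotected_three_guard _ _ k alpha x i c xI k3 nk a2 hi low.
have [n5|n5] := eqVneq n 5%N; last by lia.
(* For [n = 5] the bound reads [4 < #|F|]; excluding 5 makes up for the missing unit. *)
have F5 : #|F| != 5%N by apply/eqP => e; exact: ex.
have ek : k = 3%N by lia.
have ea : alpha = 2%N by lia.
have eX : X = 2%N by rewrite /X n5 ek ea.
have eT : 'C(n.-1, k.-1) = 6%N by rewrite n5 ek.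
move: bound; rewrite -/X eX eT; lia.
Qed.

Theorem theorem2 (F : finFieldType) (n k alpha : nat) :
  (1 <= k)%N -> (k < n)%N -> (2 <= alpha)%N -> (alpha <= n - k)%N ->
  (2 < #|F|)%N ->
  ('C(n.-1, k.-1) - 'C((ceil_div n alpha).-1, (ceil_div k alpha).-1) < #|F|)%N ->
  forall x : nat -> F,
    (forall u v, (1 <= u <= n)%N -> (1 <= v <= n)%N -> x u = x v -> u = v) ->
  exists theta : nat -> nat -> nat -> F,
    (forall b i j, theta b i j != 0 /\ theta b i j != 1) /\
    st_rs_is_MDS n k alpha x theta.
Proof.
move=> k1 kn a2 ank F2 bound x xI.
have an : (1 <= alpha <= n)%N by lia. have nk : (k + alpha <= n)%N by lia.
have [t0 /andP[t00 t01]] : exists t : F, (t != 0) && (t != 1).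
  apply/existsP; apply: contraLR F2; rewrite negb_exists -leqNgt => /forallP h.
  rewrite -cardsT -[2%N]/(1.+1)%N; apply: (@leq_trans #|[set 0; 1 : F]|); last by rewrite cards2; case: eqP.
  apply: subset_leq_card; apply/fintype.subsetP => t _; rewrite !inE.
  by have := h t; rewrite negb_and !negbK.
suff [tau [tau01 R]] : exists tau : nat -> nat -> F,
    (forall i (c : 'I_n), (1 <= i <= alpha)%N -> tau i c.+1 != 0 /\ tau i c.+1 != 1) /\
    (forall S : {set 'I_n}, #|S| = k -> recoverable k alpha x tau S).
  (* Every value of [theta] must avoid 0 and 1, so positions outside the array receive the default
     [t0]; the kernels do not see them. *)
  pose tau' i c := if (1 <= i <= alpha)%N && (1 <= c <= n)%N then tau i c else t0.
  exists (column_theta alpha tau'); split.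
    move=> b i j; rewrite /column_theta /tau'; case: ifP => // /andP[hi hc].
    have hc' : ((b * alpha + j).-1 < n)%N by lia.
    by have := tau01 i (Ordinal hc') hi; rewrite /= prednK //; lia.
  apply: st_rs_is_MDS_recoverable => S Sk d Kd; apply: (R S Sk).
  apply: st_kernel_eq an _ Kd => i c hi cS.
  by rewrite /tau' hi /= ltn_ord subrr mul0r.
pose ps := [seq (i, c) | i <- iota 1 alpha, c <- enum 'I_n].
have psP i (c : 'I_n) : ((i, c) \in ps) = (1 <= i <= alpha)%N.
  apply/allpairsP/idP => [[[i' c'] /= [hi _ [-> _]]]|hi].
    by move: hi; rewrite mem_iota; lia.
  by exists (i, c); rewrite /= mem_enum mem_iota; split=> //; lia.
have ups : uniq ps by apply: allpairs_uniq; rewrite ?iota_uniq ?enum_uniq // => -[? ?] [? ?] _ _ [-> ->].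
have [[n5 F5 k3]|nex] := pselect [/\ n = 5%N, #|F| = 5%N & (3 <= k)%N]; last first.
  have [|||tau [h1 _ h3]] := @recoverable_extend F n k alpha x ps (fun _ _ => 0) an ups.
  - by move=> _ _; rewrite eq_sym oner_neq0.
  - move=> [i c]; rewrite psP => hi; split=> //=.
    by apply: unprotected_card => // n5 F5 k3; case: nex.
  - by move=> S Sk; apply: recoverable0 => //; lia.
  by exists tau; split=> // i c hi; apply: (h1 (i, c)); rewrite psP.
have ek : k = 3%N by lia.
have ea : alpha = 2%N by lia.
subst n k alpha.
have [t [tn0 tn1 Rt]] := recoverable_5_3_2 F5 xI.
(* Node 3, the first column of the last block, as an ordinal counted from 0. *)
pose c3 : 'I_5 := inord 2.
have c3E : c3.+1 = 3%N by rewrite /c3 inordK.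
have upd i (c : 'I_5) : update (fun _ _ => 0) 2 3 t i c.+1 = if (i, c) == (2%N, c3) then t else 0.
  by rewrite /update xpair_eqE -(val_eqE c c3) /= inordK.
have [|||tau [h1 h2 h3]] := @recoverable_extend F 5 3 2 x
  [seq p <- ps | p != (2%N, c3)] (update (fun _ _ => 0) 2 3 t) an (filter_uniq _ ups).
- by move=> i c; rewrite /update; case: ifP => // _; rewrite eq_sym oner_neq0.
- move=> [i c]; rewrite mem_filter psP => /andP[ne hi]; rewrite /= upd (negPf ne); split=> //.
  (* A (B2) position needs a block of width 3. This is the last block, where [m = 1], so the
     position is row 2 of node 3, which was set aside. *)
  apply: unprotected_card => // _ _ _ /andP[h4 h5]; case/eqP: ne.
  have [bL hj ec] := col_spec c an; have hw := col_width_bounds c an.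
  have w3 : (2 < col_width 2 c)%N by lia.
  move: w3; rewrite /col_width /st_width; case: eqP => // eb _.
  congr (_, _); first by lia.
  apply/val_inj/succn_inj; rewrite /= c3E ec eb; move: h4 hj hw h5 hi; rewrite /col_width /st_width eb /=; lia.
- exact: Rt.
exists tau; split=> // i c hi.
have [e|ne] := eqVneq (i, c) (2%N, c3); last by apply: (h1 (i, c)); rewrite mem_filter ne psP.
by rewrite h2 ?upd ?e ?eqxx // mem_filter eqxx.
Qed.
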